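(* For every $p\in(0,1)$ there is a non-adaptive monotonicity tester for functions $f\colon\{0,1\}^n\to\{0,1\}$ with respect to the measure $\mu_p^{\otimes n}$ that makes $\tilde{O}(\sqrt{n}/\varepsilon^2)$ queries. That is, there is a non-adaptive randomized algorithm that, given $n$, $\varepsilon>0$ and oracle access to $f$, makes $\tilde{O}(\sqrt{n}/\varepsilon^2)$ queries, accepts with probability $1$ whenever $f$ is monotone, and rejects with probability at least $2/3$ whenever $f$ is $\varepsilon$-far from monotone with respect to $\mu_p^{\otimes n}$.
   Context: $\{0,1\}^n$ is ordered coordinatewise: $x\le y$ iff $x_i\le y_i$ for all $i$; $f$ is monotone if $x\le y$ implies $f(x)\le f(y)$. The $p$-biased measure is $\mu_p^{\otimes n}(x)=p^{|x|}(1-p)^{n-|x|}$, where $|x|$ is the Hamming weight. For a probability measure $\mu$, the distance of $f$ from monotone is $\varepsilon(f;\mu)=\min_{g \text{ monotone}}\mu(\{x: f(x)\neq g(x)\})$, and $f$ is $\varepsilon$-far from monotone if $\varepsilon(f;\mu)\ge\varepsilon$. A tester is non-adaptive if its queries do not depend on previous answers. $\tilde{O}(\cdot)$ hides factors polylogarithmic in $n$ and $1/\varepsilon$. *)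

(* Defs.v *)
From HB Require Import structures.
From mathcomp Require Import all_boot all_order all_algebra.
From mathcomp Require Import reals exp.
Set Implicit Arguments.
Unset Strict Implicit.
Unset Printing Implicit Defensive.
Import Order.TTheory GRing.Theory Num.Theory.
Local Open Scope ring_scope.

Definition cube (n : nat) := {ffun 'I_n -> bool}.

Definition cube_le (n : nat) (x y : cube n) : bool :=
  [forall i, (x i <= y i)%N].

Definition boolfun (n : nat) := {ffun cube n -> bool}.

Definition monotone (n : nat) (f : boolfun n) : bool :=
  [forall x, forall y, cube_le x y ==> (f x <= f y)%N].

Definition hamming_weight (n : nat) (x : cube n) : nat := #|[set i | x i]|.

Section Distance.
Variables (R : realType) (n : nat).

(* A measure on the (finite) cube is given by its point masses. *)
Definition biased (p : R) (x : cube n) : R :=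
  p ^+ hamming_weight x * (1 - p) ^+ (n - hamming_weight x).

Definition disagreement (mu : cube n -> R) (f g : boolfun n) : R :=
  \sum_(x | f x != g x) mu x.

(* The search starts at the constant function 0, which is monotone, so this is
   the minimum over monotone functions for every mu. *)
Definition dist_monotone (mu : cube n -> R) (f : boolfun n) : R :=
  disagreement mu f
    [arg min_(g < [ffun=> false] : boolfun n | monotone g)
       disagreement mu f g]%O.

Definition far_from_monotone (mu : cube n -> R) (eps : R) (f : boolfun n) :=
  eps <= dist_monotone mu f.

(* A randomized non-adaptive query algorithm: the random coins s determine the
   whole list of queries, hence independently of f; the verdict (true =
   accept) depends only on s and on the list of answers.  Finitely many coin
   outcomes lose no generality, since only finitely many deterministic
   non-adaptive algorithms with a given number of queries exist. *)
Record nonadaptive_algorithm := NonadaptiveAlgorithm {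
  coins : finType;
  coin_mass : coins -> R;
  coin_mass_ge0 : forall s, 0 <= coin_mass s;
  coin_mass_sum1 : \sum_s coin_mass s = 1;
  queries : coins -> seq (cube n);
  verdict : coins -> seq bool -> bool
}.

Definition accepts (T : nonadaptive_algorithm) (f : boolfun n) (s : coins T) :=
  verdict s [seq f x | x <- queries s].

Definition prob_accept (T : nonadaptive_algorithm) (f : boolfun n) : R :=
  \sum_(s : coins T | accepts f s) coin_mass s.

Definition prob_reject (T : nonadaptive_algorithm) (f : boolfun n) : R :=
  \sum_(s : coins T | ~~ accepts f s) coin_mass s.

Definition query_complexity (T : nonadaptive_algorithm) : nat :=
  \max_(s : coins T) size (queries s).

Definition monotonicity_tester (mu : cube n -> R) (eps : R)
    (T : nonadaptive_algorithm) : Prop :=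
  (forall f, monotone f -> prob_accept T f = 1) /\
  (forall f, far_from_monotone mu eps f -> 2 / 3 <= prob_reject T f).

End Distance.

(* q = O~(g), hiding factors polylogarithmic in n and 1/eps.  The shifts by 2
   keep both logarithms bounded away from 0 for all n and all eps > 0. *)
Definition soft_O (R : realType) (q g : nat -> R -> R) : Prop :=
  exists (C : R) (k : nat), forall (n : nat) (eps : R), 0 < eps ->
    q n eps <= C * g n eps * (ln (n%:R + 2) + ln (eps^-1 + 2)) ^+ k.

(* Main.v *)
(** A decreasing edge of [f] is an edge of the cube along which [f] drops from
1 to 0.  The heart of the proof is a robust directed Talagrand inequality: if
every decreasing edge is counted at one of its two ends, and [A x] is the set of
edges counted at [x], then the mean of [sqrt |A x|] is at least the distance of
[f] to monotone functions, up to a logarithm.  To prove it, sort [f] along the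
directions of a random set [S] in a fixed order.  Sorting carries the sets [A]
along without increasing the mean of the square roots, and toggling one direction
[j] in [S] changes the sorted value at a point only if [j] is counted there.  So
the undirected Talagrand inequality, applied for each point to the sorted value
as a function of [S], shows that sorting along two independent random sets gives
almost the same function; sorting along all directions is reached from sorting
along nothing by repeatedly halving the set.

For the tester, orient the decreasing edges so that vertices of out-degree about
[d] receive only [O(d)] edges from each other, and pick the dyadic [d] and the
set [V] of such vertices that carry most of the Talagrand sum.  If the total
influence exceeds [4 sqrt N], decreasing edges are abundant and a random edge is
decreasing with probability [1 / sqrt N].  Otherwise a random upward jump of rate
[q] much smaller than [1 / sqrt N] rarely changes [f], so jumping from [V] along
one of its [d] decreasing edges lands on a point where the drop persists.

A [p]-biased bit is, up to a negligible error, a monotone function of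
[O(log n)] fair bits, and a monotone coupling of its two fibres shows that
composing with it does not decrease the distance to monotone functions. *)

Require Import Defs.
From HB Require Import structures.
From mathcomp Require Import all_boot all_order all_algebra.
From mathcomp Require Import boolp reals sequences exp.
From mathcomp Require Import ring lra zify.
Set Implicit Arguments.
Unset Strict Implicit.
Unset Printing Implicit Defensive.
Import Order.TTheory GRing.Theory Num.Theory.
Local Open Scope ring_scope.

(** * Averages on the cube and the undirected Talagrand inequality *)

Section Average.
Variables (R : realType) (T : finType).
Implicit Types F G : T -> R.

Definition avg F : R := #|T|%:R^-1 * \sum_t F t.

Lemma eq_avg F G : F =1 G -> avg F = avg G.
Proof. by move=> h; rewrite /avg; congr (_ * _); apply: eq_bigr => t _. Qed.

Lemma avgD F G : avg (fun t => F t + G t) = avg F + avg G.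
Proof. by rewrite /avg big_split /= mulrDr. Qed.

Lemma avgZ c F : avg (fun t => c * F t) = c * avg F.
Proof. by rewrite /avg -mulr_sumr mulrCA. Qed.

Lemma avgB F G : avg (fun t => F t - G t) = avg F - avg G.
Proof.
by rewrite /avg sumrB mulrBr.
Qed.

Lemma le_avg F G : (forall t, F t <= G t) -> avg F <= avg G.
Proof.
move=> h; rewrite /avg; apply: ler_wpM2l; first by rewrite invr_ge0 ler0n.
by apply: ler_sum => t _.
Qed.

Lemma avg_ge0 F : (forall t, 0 <= F t) -> 0 <= avg F.
Proof.
move=> h; rewrite /avg mulr_ge0 ?invr_ge0 ?ler0n //.
by apply: sumr_ge0 => t _.
Qed.

Lemma avg_bij (h : T -> T) F : bijective h -> avg (fun t => F (h t)) = avg F.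
Proof. by move=> bh; rewrite /avg; congr (_ * _); rewrite [RHS](reindex h) //; exact: onW_bij. Qed.

Lemma avg_sum (J : finType) (P : pred J) (F : J -> T -> R) :
  avg (fun t => \sum_(j | P j) F j t) = \sum_(j | P j) avg (F j).
Proof. by rewrite /avg exchange_big /= mulr_sumr. Qed.

Lemma avg_const c : (0 < #|T|)%N -> avg (fun=> c) = c.
Proof.
move=> T0; rewrite /avg sumr_const -(mulr_natr c) mulrCA mulVf ?mulr1 //.
by rewrite pnatr_eq0 -lt0n.
Qed.

End Average.

Lemma avg_exchange (R : realType) (T U : finType) (F : T -> U -> R) :
  avg (fun t => avg (F t)) = avg (fun u => avg (F^~ u)).
Proof.
rewrite /avg -[in LHS]mulr_sumr -[in RHS]mulr_sumr mulrCA; congr (_ * (_ * _)).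
exact: exchange_big.
Qed.

(** The Euclidean norm is convex: pair each vector (u, v) with the mean vector and apply
    Cauchy-Schwarz pointwise. *)
Lemma avg_sqrtD (R : realType) (T : finType) (u v : T -> R) :
  Num.sqrt (avg u ^+ 2 + avg v ^+ 2)
    <= avg (fun t => Num.sqrt (u t ^+ 2 + v t ^+ 2)).
Proof.
set a := avg u; set b := avg v; set D := Num.sqrt _; set S := avg _.
have S0 : 0 <= S by apply: avg_ge0 => t; exact: sqrtr_ge0.
have D0 : 0 <= D by exact: sqrtr_ge0.
have [->//|Dn] := eqVneq D 0.
have {}D0 : 0 < D by rewrite lt_def Dn D0.
rewrite -(ler_pM2r D0).
have -> : D * D = avg (fun t => a * u t + b * v t).
  rewrite avgD !avgZ -/a -/b -expr2 sqr_sqrtr ?expr2 //.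
  by rewrite addr_ge0 // -expr2 sqr_ge0.
rewrite [S * D]mulrC -avgZ; apply: le_avg => t.
apply: le_trans (ler_norm _) _.
rewrite -sqrtr_sqr /D -sqrtrM; last by rewrite addr_ge0 ?sqr_ge0.
apply: ler_wsqrtr.
have := sqr_ge0 (a * v t - b * u t); rewrite -subr_ge0 => h.
rewrite -subr_ge0; apply: le_trans h _.
rewrite le_eqVlt; apply/orP; left; apply/eqP; ring.
Qed.

Section Cube.
Variables (R : realType) (I : finType).

Definition pt := {ffun I -> bool}.
Implicit Types (x y m : pt) (i j : I) (s : seq I).

Definition setc x i b : pt := [ffun j => if j == i then b else x j].
Definition flip x i : pt := setc x i (~~ x i).
Definition mix s m x : pt := [ffun j => if j \in s then m j else x j].

Lemma card_pt_gt0 : (0 < #|{: pt}|)%N.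
Proof. by apply/card_gt0P; exists [ffun=> false]. Qed.

Lemma setc_id x i : setc x i (x i) = x.
Proof. by apply/ffunP => j; rewrite ffunE; case: eqP => [->|]. Qed.

Lemma setcE x i b : setc x i b i = b.
Proof. by rewrite ffunE eqxx. Qed.

Lemma setc_neq x i b j : j != i -> setc x i b j = x j.
Proof. by rewrite ffunE => /negbTE ->. Qed.

Lemma setcK x i b c : setc (setc x i b) i c = setc x i c.
Proof. by apply/ffunP => j; rewrite !ffunE; case: eqP. Qed.

Lemma setcC x i j b c : i != j -> setc (setc x i b) j c = setc (setc x j c) i b.
Proof.
move=> ij; apply/ffunP => k; rewrite !ffunE.
by have [->|//] := eqVneq k j; rewrite eq_sym (negbTE ij).
Qed.

Lemma flipE x i : flip x i i = ~~ x i.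
Proof. by rewrite setcE. Qed.

Lemma flipK i : involutive (flip^~ i).
Proof. by move=> x; rewrite /flip setcE setcK negbK setc_id. Qed.

Lemma flip_setc x i b : flip (setc x i b) i = setc x i (~~ b).
Proof. by rewrite /flip setcE setcK. Qed.

Lemma flip_inj x : injective (flip x).
Proof.
move=> i j /ffunP /(_ i); rewrite flipE.
by have [//|ij] := eqVneq i j; rewrite setc_neq //; case: (x i).
Qed.

Lemma flip_bij i : bijective (flip^~ i).
Proof. exact: inv_bij (flipK i). Qed.

Lemma avg_pt_const (c : R) : avg (fun _ : pt => c) = c.
Proof. by apply: avg_const; exact: card_pt_gt0. Qed.

Lemma avg_flip i (F : pt -> R) : avg (fun x => F (flip x i)) = avg F.
Proof. by rewrite (avg_bij (h := flip^~ i)) //; exact: flip_bij. Qed.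

Lemma avg_coord i (F : pt -> R) :
  avg F = avg (fun x => (F (setc x i false) + F (setc x i true)) / 2).
Proof.
transitivity (avg (fun x => 2^-1 * (F x + F (flip x i)))).
  by rewrite avgZ avgD avg_flip; lra.
apply: eq_avg => x; rewrite mulrC; congr (_ / _).
by rewrite -{1}(setc_id x i) /flip; case: (x i) => //=; rewrite addrC.
Qed.

Lemma mix_cons i s m x b : i \notin s ->
  mix (i :: s) (setc m i b) x = mix s m (setc x i b).
Proof.
move=> is_; apply/ffunP => j; rewrite !ffunE inE.
by have [->|] := eqVneq j i; rewrite ?(negbTE is_).
Qed.

Lemma mix_setc i s m x b : i \notin s -> mix s m (setc x i b) = setc (mix s m x) i b.
Proof.
move=> is_; apply/ffunP => j; rewrite !ffunE.
by have [->|] := eqVneq j i; rewrite ?(negbTE is_).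
Qed.

Definition avg_on s (g : pt -> R) x : R := avg (fun m => g (mix s m x)).

Lemma avg_on_cons i s g x : i \notin s ->
  avg_on (i :: s) g x = (avg_on s g (setc x i false) + avg_on s g (setc x i true)) / 2.
Proof.
move=> is_; rewrite /avg_on (avg_coord i) mulrC -avgD -avgZ.
by apply: eq_avg => m; rewrite mulrC !mix_cons.
Qed.

Lemma sqrt_natE (n : nat) : Num.sqrt (n%:R : R) ^+ 2 = n%:R.
Proof. by rewrite sqr_sqrtr ?ler0n. Qed.

(** Induction on the coordinates in [s]. A new direction [i] adds the indicator of [i \in A y] under
    the square root, and [avg_sqrtD] separates the two contributions: the old one is bounded by
    induction on both halves, the new one by the change of mean between them. *)
Lemma talagrand_on s (G : pt -> bool) (A : pt -> {set I}) x :
  uniq s ->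
  (forall y i, G y != G (flip y i) -> (i \in A y) || (i \in A (flip y i))) ->
  let p := avg_on s (fun y => (G y)%:R) x in
  p * (1 - p) <= avg_on s (fun y => Num.sqrt #|A y :&: [set j in s]|%:R) x.
Proof.
move=> us cov; elim: s us x => [_ x|i s IH /= /andP [is_ us] x].
  rewrite /avg_on /=.
  have E m : mix [::] m x = x by apply/ffunP => j; rewrite ffunE in_nil.
  under eq_avg do rewrite E; rewrite avg_pt_const.
  under eq_avg do rewrite E; rewrite avg_pt_const.
  apply: le_trans (sqrtr_ge0 _).
  by case: (G x) => /=; lra.
rewrite avg_on_cons //.
set p0 := avg_on s _ (setc x i false); set p1 := avg_on s _ (setc x i true).
pose u y : R := Num.sqrt #|A y :&: [set j in s]|%:R.
pose v y : R := (i \in A y)%:R.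
have -> : avg_on (i :: s) (fun y => Num.sqrt #|A y :&: [set j in i :: s]|%:R) x
    = avg_on (i :: s) (fun y => Num.sqrt (u y ^+ 2 + v y ^+ 2)) x.
  apply: eq_avg => m; rewrite /u /v sqrt_natE; set y := mix _ _ _.
  congr Num.sqrt; have -> : (((i \in A y)%:R : R) ^+ 2 = (i \in A y)%:R).
    by case: (i \in A y); rewrite ?expr1n ?expr0n.
  rewrite -natrD; congr (_%:R).
  have -> : [set j in i :: s] = i |: [set j in s] by apply/setP => j; rewrite !inE.
  rewrite setIUr; have [iA|iA] := boolP (i \in A y).
    rewrite (setIidPr _) ?sub1set // cardsU1 !inE (negbTE is_) andbF /=; lia.
  suff -> : A y :&: [set i] = set0 by rewrite set0U addn0.
  by apply/setP => j; rewrite !inE; case: eqP => [->|]; rewrite ?(negbTE iA) ?andbF.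
apply: le_trans (avg_sqrtD _ _).
set U := avg _; set V := avg _.
have hU : (p0 * (1 - p0) + p1 * (1 - p1)) / 2 <= U.
  have -> : U = avg_on (i :: s) u x by [].
  rewrite avg_on_cons //; apply: ler_wpM2r; first by rewrite invr_ge0 ler0n.
  by apply: lerD; exact: IH.
(* On each [i]-edge where [G] changes, [cov] makes [v] equal to 1 at one end at least. *)
have hV : `|p1 - p0| / 2 <= V.
  have -> : V = avg_on (i :: s) v x by [].
  rewrite avg_on_cons //; apply: ler_wpM2r; first by rewrite invr_ge0 ler0n.
  rewrite /p0 /p1 /avg_on -avgB -avgD.
  have norm_avg (F : pt -> R) : `|avg F| <= avg (fun t => `|F t|).
    rewrite /avg normrM ger0_norm ?invr_ge0 ?ler0n //.
    apply: ler_wpM2l; first by rewrite invr_ge0 ler0n.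
    exact: ler_norm_sum.
  apply: le_trans (norm_avg _) _; apply: le_avg => m.
  rewrite !mix_setc // /v; set y := mix _ _ _.
  have := cov (setc y i false) i; rewrite flip_setc /=.
  case: (G _); case: (G _) => /= h; rewrite ?subrr ?normr0 ?addr_ge0 ?ler0n //.
    rewrite sub0r normrN1; have /orP [] := h isT; move=> ->; rewrite ?lerDl ?lerDr ?ler0n //.
  rewrite subr0 normr1; have /orP [] := h isT; move=> ->; rewrite ?lerDl ?lerDr ?ler0n //.
have p0_01 : 0 <= p0 <= 1.
  apply/andP; split; first by apply: avg_ge0 => m; rewrite ler0n.
  by rewrite -[leRHS]avg_pt_const; apply: le_avg => m; rewrite lern1 leq_b1.
have p1_01 : 0 <= p1 <= 1.
  apply/andP; split; first by apply: avg_ge0 => m; rewrite ler0n.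
  by rewrite -[leRHS]avg_pt_const; apply: le_avg => m; rewrite lern1 leq_b1.
move: p0_01 p1_01 => /andP [a0 a1] /andP [b0 b1].
have hU0 : 0 <= (p0 * (1 - p0) + p1 * (1 - p1)) / 2 by nra.
set W := (p0 + p1) / 2 * _.
have W0 : 0 <= W by rewrite /W; nra.
rewrite -[W]ger0_norm // -sqrtr_sqr; apply: ler_wsqrtr.
apply: (@le_trans _ _ (((p0 * (1 - p0) + p1 * (1 - p1)) / 2) ^+ 2 + (`|p1 - p0| / 2) ^+ 2)); last first.
  have V0 : 0 <= `|p1 - p0| / 2 by rewrite divr_ge0.
  by apply: lerD; rewrite lerXn2r ?nnegrE // (le_trans _ hV, le_trans _ hU).
rewrite [(`|_| / 2) ^+ 2]expr_div_n real_normK ?num_real // -subr_ge0.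
set c := (X in 0 <= X).
(* With delta = (p1 - p0) / 2, the mean of the two variances is W - delta^2, so the gap factors; W
   <= 1/4 makes the second factor nonnegative. *)
have -> : c = ((p1 - p0) / 2) ^+ 2 * (1 - 2 * W + ((p1 - p0) / 2) ^+ 2) by rewrite /c /W; field.
apply: mulr_ge0; first exact: sqr_ge0.
apply: addr_ge0; last exact: sqr_ge0.
have := sqr_ge0 (p0 + p1 - 1); rewrite /W; nra.
Qed.

(* Talagrand's inequality, in the robust form where each sensitive edge need
   only be counted at one of its endpoints. *)
Lemma talagrand (G : pt -> bool) (A : pt -> {set I}) :
  (forall y i, G y != G (flip y i) -> (i \in A y) || (i \in A (flip y i))) ->
  let p := avg (fun y => (G y)%:R : R) in
  p * (1 - p) <= avg (fun y => Num.sqrt #|A y|%:R).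
Proof.
move=> cov; have := talagrand_on (s := enum I) [ffun=> false] (enum_uniq _) cov.
have E m x : mix (enum I) m x = m by apply/ffunP => j; rewrite ffunE mem_enum.
have EA (g : pt -> R) x : avg_on (enum I) g x = avg g.
  by apply: eq_avg => m; rewrite E.
rewrite !EA => /le_trans; apply.
rewrite le_eqVlt; apply/orP; left; apply/eqP; apply: eq_avg => m.
by congr (Num.sqrt _%:R); apply: eq_card => j; rewrite !inE mem_enum andbT.
Qed.

End Cube.

(** * Sorting *)

Section Sorting.
Variables (R : realType) (I : finType).
Local Notation pt := (pt I).
Implicit Types (x y : pt) (i j : I) (s : seq I) (f g : pt -> bool)
  (A B : pt -> {set I}).

Definition srt i f x : bool :=
  if x i then f (setc x i false) || f (setc x i true)
  else f (setc x i false) && f (setc x i true).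

(* The directions counted at the two ends of an [i]-edge after sorting it: a
   decreasing edge swaps its two sets; on a constant edge the sets are replaced
   by their union and intersection, which can only decrease the sum of the
   square roots of the cardinals. *)
Definition srt_cover i f A x : {set I} :=
  let x0 := setc x i false in
  let x1 := setc x i true in
  match f x0, f x1 with
  | false, true => A x
  | true, false => A (flip x i)
  | false, false => if x i then A x0 :|: A x1 else A x0 :&: A x1
  | true, true => if x i then A x0 :&: A x1 else A x0 :|: A x1
  end.

Fixpoint sort_seq s f : pt -> bool :=
  if s is i :: s' then srt i (sort_seq s' f) else f.

Fixpoint sort_cover s f A : pt -> {set I} :=
  if s is i :: s' then srt_cover i (sort_seq s' f) (sort_cover s' f A) else A.

Definition mono_in i f := forall x, f (setc x i false) -> f (setc x i true).

Definition covers_viol i f A := forall x,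
  f (setc x i false) -> ~~ f (setc x i true) ->
  (i \in A (setc x i false)) || (i \in A (setc x i true)).

Lemma srt_setc i f x b :
  srt i f (setc x i b) =
  if b then f (setc x i false) || f (setc x i true)
  else f (setc x i false) && f (setc x i true).
Proof. by rewrite /srt setcE !setcK. Qed.

Lemma srt_mono i f : mono_in i (srt i f).
Proof. by move=> x; rewrite !srt_setc => /andP [->]. Qed.

Lemma srt_mono_in i j f : mono_in j f -> mono_in j (srt i f).
Proof.
have [<- _|ij] := eqVneq i j; first exact: srt_mono.
move=> mf x; have ji : j != i by rewrite eq_sym.
rewrite /srt !setc_neq // ![setc (setc x j _) i _]setcC //.
move: (mf (setc x i false)) (mf (setc x i true)).
case: (x i); case: (f _); case: (f _); case: (f _); case: (f _) => //= h1 h2;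
  by rewrite ?h1 ?h2.
Qed.

Lemma srt_id i f : mono_in i f -> srt i f =1 f.
Proof.
move=> mf x; have -> : f x = f (setc x i (x i)) by rewrite setc_id.
rewrite /srt; have := mf x.
by case: (x i); case: (f _); case: (f _) => // h; have := h isT.
Qed.

Lemma sort_seq_mono j s f : j \in s -> mono_in j (sort_seq s f).
Proof.
elim: s => //= i s IH; rewrite inE => /orP [/eqP ->|/IH]; first exact: srt_mono.
exact: srt_mono_in.
Qed.

Lemma eq_srt i f g : f =1 g -> srt i f =1 srt i g.
Proof. by move=> h x; rewrite /srt !h. Qed.

Lemma sort_seq_id s f : (forall j, j \in s -> mono_in j f) -> sort_seq s f =1 f.
Proof.
elim: s => //= i s IH mf x.
rewrite (eq_srt i (IH _)); last by move=> j js; apply: mf; rewrite inE js orbT.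
by apply: srt_id; apply: mf; rewrite inE eqxx.
Qed.

Lemma sort_seq_cat s1 s2 f : sort_seq (s1 ++ s2) f = sort_seq s1 (sort_seq s2 f).
Proof. by elim: s1 => //= i s1 ->. Qed.

Definition dist f g : R := avg (fun x => (f x != g x)%:R).

Lemma dist_le1 f g : dist f g <= 1.
Proof.
by rewrite -[leRHS](avg_pt_const I); apply: le_avg => x; rewrite lern1 leq_b1.
Qed.

Lemma dist_triangle f g h : dist f h <= dist f g + dist g h.
Proof.
rewrite /dist -avgD; apply: le_avg => x; rewrite -natrD ler_nat.
by case: (f x); case: (g x); case: (h x).
Qed.

Lemma distC f g : dist f g = dist g f.
Proof. by apply: eq_avg => x; rewrite eq_sym. Qed.

(** Sorting an edge keeps its number of ones, and two sorted edges disagree in exactly as many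
    points as these numbers differ. *)
Lemma dist_srt i f g : dist (srt i f) (srt i g) <= dist f g.
Proof.
rewrite /dist (avg_coord i) [leRHS](avg_coord i); apply: le_avg => x.
rewrite ler_pM2r ?invr_gt0 ?ltr0n // !srt_setc -!natrD ler_nat.
by case: (f _); case: (f _); case: (g _); case: (g _).
Qed.

Lemma dist_sort_seq s f g : dist (sort_seq s f) (sort_seq s g) <= dist f g.
Proof. by elim: s => //= i s IH; apply: le_trans (dist_srt _ _ _) IH. Qed.

(** Intersection and union have the same total size as [A] and [B] but no larger product, and after
    squaring only the cross terms differ. *)
Lemma sqrtD_cardUI (A B : {set I}) :
  Num.sqrt #|A :&: B|%:R + Num.sqrt #|A :|: B|%:R
    <= Num.sqrt #|A|%:R + Num.sqrt #|B|%:R :> R.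
Proof.
have h : (#|A :&: B| + #|A :|: B| = #|A| + #|B|)%N by rewrite addnC cardsUI.
have lA : (#|A :&: B| <= #|A|)%N by rewrite subset_leq_card // subsetIl.
have lB : (#|A :&: B| <= #|B|)%N by rewrite subset_leq_card // subsetIr.
move: h lA lB; move: #|A :&: B| #|A :|: B| #|A| #|B| => a b c d h ca da.
rewrite -ler_sqr ?nnegrE ?addr_ge0 ?sqrtr_ge0 // !sqrrD !sqrt_natE.
rewrite -!sqrtrM ?ler0n // -!natrM.
have -> : (b%:R : R) = c%:R + d%:R - a%:R by rewrite -natrD -h natrD; lra.
suff : Num.sqrt (a * b)%:R <= Num.sqrt (c * d)%:R :> R.
  by rewrite !mulr2n; lra.
by apply: ler_wsqrtr; rewrite ler_nat; nia.
Qed.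

Lemma avg_sqrt_srt_cover i f A :
  avg (fun x => Num.sqrt #|srt_cover i f A x|%:R)
    <= avg (fun x => Num.sqrt #|A x|%:R) :> R.
Proof.
rewrite (avg_coord i) [leRHS](avg_coord i); apply: le_avg => x.
rewrite ler_pM2r ?invr_gt0 ?ltr0n // /srt_cover !setcE !setcK !flip_setc /=.
have := sqrtD_cardUI (A (setc x i false)) (A (setc x i true)).
by case: (f _); case: (f _) => //; lra.
Qed.

Lemma avg_sqrt_sort_cover s f A :
  avg (fun x => Num.sqrt #|sort_cover s f A x|%:R)
    <= avg (fun x => Num.sqrt #|A x|%:R) :> R.
Proof. by elim: s => //= i s IH; apply: le_trans (avg_sqrt_srt_cover _ _ _) IH. Qed.

(** A check of the values on a single [i]-edge. Two functions are carried along because this serves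
    twice: for the restrictions of one function to the two [j]-faces, and for two sortings that
    differ only in direction [j]. *)
Lemma srt_cover_step i j f g A B :
  (forall x, f x -> ~~ g x -> (j \in A x) || (j \in B x)) ->
  forall x, srt i f x -> ~~ srt i g x ->
    (j \in srt_cover i f A x) || (j \in srt_cover i g B x).
Proof.
move=> cov x; rewrite /srt /srt_cover.
have := cov (setc x i false); have := cov (setc x i true).
have [E0 E1] : A x = A (setc x i (x i)) /\ B x = B (setc x i (x i)).
  by rewrite setc_id.
rewrite E0 E1 /flip.
case: (x i) => /=; case: (f _); case: (f _); case: (g _); case: (g _) => //=;
  rewrite ?inE; do 4!case: (j \in _) => //=; by move=> // h1 h2; (have := h1 isT isT) || (have := h2 isT isT).
Qed.

Lemma sort_cover_viol j s f A : j \notin s -> covers_viol j f A ->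
  covers_viol j (sort_seq s f) (sort_cover s f A).
Proof.
elim: s => //= i s IH; rewrite inE negb_or => /andP [ji js] cov.
move=> x; have {}IH := IH js cov.
have E h y b : srt i h (setc y j b) = srt i (fun z => h (setc z j b)) y.
  by rewrite /srt setc_neq 1?eq_sym // ![setc (setc y j _) i _]setcC.
have EC h B y b : srt_cover i h B (setc y j b)
    = srt_cover i (fun z => h (setc z j b)) (fun z => B (setc z j b)) y.
  by rewrite /srt_cover /flip setc_neq 1?eq_sym // ![setc (setc y j _) i _]setcC.
rewrite !E !EC; exact: (srt_cover_step IH).
Qed.

(* Toggling whether direction [j] is sorted changes the value at [x] only when
   the [j]-edge through [x] is decreasing at the time it is sorted. *)
Lemma sort_cover_toggle j s f A (S : pt) x : uniq s -> covers_viol j f A ->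
  sort_seq (filter S s) f x != sort_seq (filter (flip S j) s) f x ->
  (j \in sort_cover (filter S s) f A x)
  || (j \in sort_cover (filter (flip S j) s) f A x).
Proof.
move=> us cov.
have one_dir (T U : pt) : (forall i, i != j -> T i = U i) -> T j = ~~ U j ->
    forall y, sort_seq (filter T s) f y -> ~~ sort_seq (filter U s) f y ->
    (j \in sort_cover (filter T s) f A y) || (j \in sort_cover (filter U s) f A y).
  move=> TU Tj; elim: s us => [_ y /= -> //|i s IH /= /andP [is_ us] y].
  have [ij|ij] := eqVneq i j; last first.
    rewrite (TU _ ij); case: (U i) => /=; last exact: IH.
    exact: (srt_cover_step (IH us)).
  (* Exactly one of the two lists sorts [j] on top of a common list. The value then changes at [y]
     only on a decreasing [j]-edge, whose two sets are swapped, so the two covers at [y] are the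
     sets at both ends. *)
  rewrite ij Tj; rewrite {}ij in is_.
  have -> : filter T s = filter U s.
    by apply: eq_in_filter => k ks; apply: TU; apply: contraNneq is_ => <-.
  have js : j \notin filter U s by rewrite mem_filter (negbTE is_) andbF.
  have := sort_cover_viol js cov; move/(_ y); set s' := filter U s.
  have Ef : sort_seq s' f y = sort_seq s' f (setc y j (y j)) by rewrite setc_id.
  have EA : sort_cover s' f A y = sort_cover s' f A (setc y j (y j)).
    by rewrite setc_id.
  case: (U j) => /=; rewrite /srt /srt_cover /flip Ef EA;
    case: (y j) => /=; case: (sort_seq _ _ _); case: (sort_seq _ _ _) => //= h _ _;
    by rewrite ?h // orbC h.
have [fl0 fl1] : (forall i, i != j -> S i = flip S j i) /\ S j = ~~ flip S j j.
  by split=> [i ij|]; rewrite ?flipE ?negbK // /flip setc_neq.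
case E : (sort_seq (filter S s) f x) => neq.
  by apply: one_dir => //; move: neq; case: (sort_seq _ _ _).
rewrite orbC; apply: one_dir.
- by move=> i ij; rewrite -fl0.
- by rewrite flipE.
- by move: neq; case: (sort_seq _ _ _).
- by rewrite E.
Qed.

(** At a fixed [x], the sorted value is a Boolean function of the random set, with mean p, so two
    independent sets disagree with probability 2 p (1 - p). [talagrand] on the cube of sets bounds p
    (1 - p), and [avg_sqrt_sort_cover] removes the sorting. *)
Lemma avg_dist_sort s f A : uniq s -> (forall j, covers_viol j f A) ->
  avg (fun S : pt => avg (fun T : pt =>
    dist (sort_seq (filter S s) f) (sort_seq (filter T s) f)))
  <= 2 * avg (fun x => Num.sqrt #|A x|%:R).
Proof.
move=> us cov.
pose G x (S : pt) := sort_seq (filter S s) f x.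
have pairs x : avg (fun S => avg (fun T => (G x S != G x T)%:R))
    = 2 * (avg (fun S => (G x S)%:R : R) * (1 - avg (fun S => (G x S)%:R))).
  set p := avg (fun S => (G x S)%:R).
  transitivity (avg (fun S => (p + (1 - 2 * p) * (G x S)%:R))).
    apply: eq_avg => S; case: (G x S) => /=.
      rewrite mulr1 (eq_avg (G := fun T => 1 - (G x T)%:R)); last first.
        by move=> T; case: (G x T) => /=; rewrite ?subrr ?subr0.
      by rewrite avgB avg_pt_const -/p; lra.
    rewrite mulr0 addr0; apply: eq_avg => T; by case: (G x T).
  by rewrite avgD avg_pt_const (avgZ (1 - 2 * p)) -/p; ring.
have -> : avg (fun S : pt => avg (fun T : pt =>
    dist (sort_seq (filter S s) f) (sort_seq (filter T s) f)))
  = avg (fun x => avg (fun S => avg (fun T => (G x S != G x T)%:R))).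
  rewrite [RHS]avg_exchange; apply: eq_avg => S.
  by rewrite /dist avg_exchange.
rewrite -avgZ (eq_avg pairs) !avgZ ler_pM2l ?ltr0n //.
apply: (@le_trans _ _ (avg (fun x => avg (fun S : pt =>
    Num.sqrt #|sort_cover (filter S s) f A x|%:R)))).
  apply: le_avg => x; apply: talagrand => S j; exact: sort_cover_toggle.
rewrite avg_exchange -[leRHS](avg_pt_const I); apply: le_avg => S.
exact: avg_sqrt_sort_cover.
Qed.

End Sorting.

(** * The directed Talagrand inequality *)

Section DirectedTalagrand.
Variables (R : realType) (I : finType).
Local Notation pt := (pt I).
Implicit Types (Q S T : pt) (Ss : seq pt).

(* The order in which directions are sorted: coordinates outside the first set
   come first (they stand last in the list, since [sort_seq] starts from the
   end), and each half is ordered recursively by the remaining sets. *)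
Fixpoint split_order Ss : seq I :=
  if Ss is U :: Ss' then
    filter U (split_order Ss') ++ filter [pred i | ~~ U i] (split_order Ss')
  else enum I.

Lemma split_order_uniq Ss : uniq (split_order Ss).
Proof.
elim: Ss => [|S Ss IH] /=; first exact: enum_uniq.
rewrite cat_uniq !filter_uniq //= andbT; apply/hasPn => i.
by rewrite !mem_filter /= => /andP [/negbTE ->].
Qed.

Lemma mem_split_order Ss i : i \in split_order Ss.
Proof.
elim: Ss => [|S Ss IH] /=; first by rewrite mem_enum.
by rewrite mem_cat !mem_filter /= IH !andbT orbN.
Qed.

Fixpoint avg_seq (m : nat) (G : seq pt -> R) : R :=
  if m is m'.+1 then avg_seq m' (fun Ss => avg (fun S : pt => G (S :: Ss)))
  else G [::].

Lemma le_avg_seq m G H : (forall Ss, G Ss <= H Ss) -> avg_seq m G <= avg_seq m H.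
Proof.
elim: m G H => [|m IH] G H h /=; first exact: h.
by apply: IH => Ss; apply: le_avg => S.
Qed.

Lemma eq_avg_seq m G H : G =1 H -> avg_seq m G = avg_seq m H.
Proof. by move=> h; apply/le_anti; rewrite !le_avg_seq // => Ss; rewrite h. Qed.

Lemma avg_seqDr m G c : avg_seq m (fun Ss => G Ss + c) = avg_seq m G + c.
Proof.
elim: m G => //= m IH G; rewrite -IH; apply: eq_avg_seq => Ss.
by rewrite avgD avg_pt_const.
Qed.

Lemma avg_seq_const m c : avg_seq m (fun=> c) = c.
Proof.
elim: m => //= m IH; rewrite -[RHS]IH; apply: eq_avg_seq => Ss.
by rewrite avg_pt_const.
Qed.

Lemma avg_seq_exchange m (G : pt -> seq pt -> R) :
  avg_seq m (fun Ss => avg (fun S : pt => G S Ss))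
  = avg (fun S : pt => avg_seq m (G S)).
Proof.
elim: m G => //= m IH G; rewrite -IH; apply: eq_avg_seq => Ss.
by rewrite avg_exchange.
Qed.

Definition ptI Q S : pt := [ffun i => Q i && S i].

Variables (f : pt -> bool) (A : pt -> {set I}).
Hypothesis cov : forall j, covers_viol j f A.

Let Phi : R := avg (fun x => Num.sqrt #|A x|%:R).
Let sorted_dist Q Ss : R := dist R f (sort_seq (filter Q (split_order Ss)) f).

(** A set and its complement are not independent, but each is independent of a third set [T]; the
    triangle inequality through the sorting along [T] doubles the bound of [avg_dist_sort]. *)
Lemma avg_dist_complement Q Ss :
  avg (fun S : pt => dist R
    (sort_seq (filter (ptI Q S) (split_order Ss)) f)
    (sort_seq (filter (ptI Q [ffun i => ~~ S i]) (split_order Ss)) f))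
  <= 4 * Phi.
Proof.
set s := split_order Ss; pose F S := sort_seq (filter (ptI Q S) s) f.
have H : avg (fun S => avg (fun T => dist R (F S) (F T))) <= 2 * Phi.
  have us : uniq (filter Q s) by rewrite filter_uniq // split_order_uniq.
  have := avg_dist_sort R us cov; apply: le_trans.
  rewrite le_eqVlt; apply/orP; left; apply/eqP.
  apply: eq_avg => S; apply: eq_avg => T; rewrite /F -!filter_predI.
  by congr (dist R (sort_seq _ f) (sort_seq _ f)); apply: eq_filter => i;
    rewrite /= ffunE andbC.
have inv : involutive (fun S : pt => [ffun i => ~~ S i] : pt).
  by move=> S; apply/ffunP => i; rewrite !ffunE negbK.
have H' : avg (fun S => avg (fun T => dist R (F T) (F [ffun i => ~~ S i]))) <= 2 * Phi.
  apply: le_trans _ H; rewrite le_eqVlt; apply/orP; left; apply/eqP.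
  rewrite (avg_bij (fun S => avg (fun T => dist R (F T) (F S))) (inv_bij inv)).
  by apply: eq_avg => S; apply: eq_avg => T; rewrite distC.
apply: (@le_trans _ _ (2 * Phi + 2 * Phi)); last by lra.
apply: le_trans (lerD H H'); rewrite -avgD; apply: le_avg => S.
rewrite -avgD -[leLHS](avg_pt_const I); apply: le_avg => T.
exact: dist_triangle.
Qed.

(** The list for [S :: Ss] is the part inside [S] followed by the part outside. Since sorting twice
    along the first part changes nothing and sorting contracts [dist], applying the second part
    before the first costs at most the distance between the two partial sortings. *)
Lemma sorted_dist_cons Q S Ss :
  sorted_dist Q (S :: Ss) <= sorted_dist (ptI Q S) Ss +
   dist R
    (sort_seq (filter (ptI Q S) (split_order Ss)) f)
    (sort_seq (filter (ptI Q [ffun i => ~~ S i]) (split_order Ss)) f).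
Proof.
rewrite /sorted_dist /= filter_cat -!filter_predI.
set s := split_order Ss.
have -> : filter (predI Q S) s = filter (ptI Q S) s.
  by apply: eq_filter => i; rewrite /= ffunE.
have -> : filter (predI Q [pred i | ~~ S i]) s = filter (ptI Q [ffun i => ~~ S i]) s.
  by apply: eq_filter => i; rewrite /= !ffunE.
rewrite sort_seq_cat; set s1 := filter _ s; set s2 := filter _ s.
apply: le_trans (dist_triangle _ _ (sort_seq s1 f) _) _; rewrite lerD2l.
apply: le_trans (dist_sort_seq R s1 (sort_seq s1 f) _).
rewrite le_eqVlt; apply/orP; left; apply/eqP; apply: eq_avg => x.
by rewrite (sort_seq_id (s := s1) (f := sort_seq s1 f)) // => j; exact: sort_seq_mono.
Qed.

(** Each halving costs [4 * Phi] and halves the expected size of the set. The last term bounds the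
    probability that the set is still nonempty after [m] halvings. *)
Lemma avg_sorted_dist m Q :
  avg_seq m (sorted_dist Q) <= 4 * m%:R * Phi + (\sum_i (Q i)%:R) / 2 ^+ m.
Proof.
elim: m Q => [|m IH] Q /=.
  rewrite mulr0 mul0r add0r expr0 divr1 /sorted_dist.
  have [/existsP [i Qi]|/existsPn Q0] := boolP [exists i, Q i].
    apply: le_trans (dist_le1 _ _ _) _.
    by rewrite (bigD1 i) //= Qi lerDl sumr_ge0 // => j _; rewrite ler0n.
  rewrite (eq_filter (a2 := pred0)); last by move=> i; exact/negbTE/Q0.
  rewrite filter_pred0 /= /dist (eq_avg (G := fun=> 0)).
    by rewrite avg_pt_const sumr_ge0 // => i _; rewrite ler0n.
  by move=> x; rewrite eqxx.
pose delta S Ss := dist R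
    (sort_seq (filter (ptI Q S) (split_order Ss)) f)
    (sort_seq (filter (ptI Q [ffun i => ~~ S i]) (split_order Ss)) f).
apply: (@le_trans _ _ (avg_seq m (fun Ss =>
    avg (fun S => sorted_dist (ptI Q S) Ss) + 4 * Phi))).
  apply: le_avg_seq => Ss.
  apply: le_trans (lerD (lexx _) (avg_dist_complement Q Ss)).
  rewrite -avgD; apply: le_avg => S; exact: sorted_dist_cons.
rewrite avg_seqDr avg_seq_exchange.
have half : avg (fun S => \sum_i (ptI Q S i)%:R) = (\sum_i (Q i)%:R) / 2 :> R.
  rewrite avg_sum mulr_suml; apply: eq_bigr => i _.
  rewrite (avg_coord i) (eq_avg (G := fun=> (Q i)%:R / 2)) ?avg_pt_const //.
  by move=> S; rewrite !ffunE eqxx andbF andbT add0r.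
apply: (@le_trans _ _ (avg (fun S => 4 * m%:R * Phi
    + (2 ^+ m)^-1 * \sum_i (ptI Q S i)%:R) + 4 * Phi)).
  rewrite lerD2r; apply: le_avg => S; rewrite [_^-1 * _]mulrC; exact: IH.
rewrite avgD avg_pt_const avgZ half exprS -natr1 le_eqVlt; apply/orP; left.
by apply/eqP; field; rewrite expf_neq0 // pnatr_eq0.
Qed.

Lemma directed_talagrand (eps : R) (m : nat) :
  (forall g, (forall j, mono_in j g) -> eps <= dist R f g) ->
  eps <= 4 * m%:R * Phi + #|I|%:R / 2 ^+ m.
Proof.
move=> far; have := avg_sorted_dist m [ffun=> true].
have -> : \sum_(i : I) ([ffun=> true] i : bool)%:R = #|I|%:R :> R.
  by rewrite -sum1_card natr_sum; apply: eq_bigr => i _; rewrite ffunE.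
apply: le_trans; rewrite -[leLHS](avg_seq_const m); apply: le_avg_seq => Ss.
apply: far => j; apply: sort_seq_mono.
by rewrite mem_filter ffunE mem_split_order.
Qed.

End DirectedTalagrand.

(** * Orienting the decreasing edges *)

Section Orientation.
Variable I : finType.
Local Notation pt := (pt I).
Implicit Types (x y : pt) (j : I) (A : pt -> {set I}).

Definition viol (f : pt -> bool) x j : bool :=
  f (setc x j false) && ~~ f (setc x j true).

Lemma viol_flip f x j : viol f (flip x j) j = viol f x j.
Proof. by rewrite /viol /flip !setcK. Qed.

Lemma viol_end f x j : viol f x j -> f (flip x j) = ~~ f x.
Proof.
have -> : f x = f (setc x j (x j)) by rewrite setc_id.
by rewrite /viol /flip; case: (x j) => /= /andP [-> /negbTE ->].
Qed.

Lemma viol_coord f x j : viol f x j -> x j = ~~ f x.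
Proof.
have -> : f x = f (setc x j (x j)) by rewrite setc_id.
by rewrite /viol; case: (x j) => /andP [h0 /negbTE h1]; rewrite ?h0 ?h1.
Qed.

Definition orientation (f : pt -> bool) A :=
  forall x j, ((j \in A x) + (j \in A (flip x j)) = viol f x j)%N.

Lemma orientation_viol f A x j : orientation f A -> j \in A x -> viol f x j.
Proof. by move=> /(_ x j) + jA; rewrite jA; case: (viol f x j). Qed.

Lemma orientation_covers f A j : orientation f A -> covers_viol j f A.
Proof.
move=> orA x f0 f1; have := orA (setc x j false) j.
rewrite flip_setc /viol !setcK f0 f1 /=.
by case: (j \in _) => //; case: (j \in _).
Qed.

(* Among all orientations, take one maximising the sum of the squares of the
   out-degrees: reversing all the edges that enter [y] from vertices of
   out-degree at most [t] would otherwise increase that sum. *)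
Lemma balanced_orientation (f : pt -> bool) : exists2 A,
  orientation f A &
  forall y t, (#|[set j | (j \in A (flip y j)) && (#|A (flip y j)| <= t)%N]|
                <= 2 * t)%N.
Proof.
pose orb (A : {ffun pt -> {set I}}) :=
  [forall x, forall j, ((j \in A x) + (j \in A (flip x j)) == viol f x j)%N].
have orbP (A : {ffun pt -> {set I}}) : reflect (orientation f A) (orb A).
  apply: (iffP forallP) => h x; first by move=> j; exact/eqP/(forallP (h x)).
  by apply/forallP => j; apply/eqP.
pose A0 : {ffun pt -> {set I}} := [ffun x => [set j | viol f x j && f x]].
have or0 : orb A0.
  apply/orbP => x j; rewrite !ffunE !inE viol_flip.
  by have [v|//] := boolP (viol f x j); rewrite (viol_end v); case: (f x).
pose pot (A : {ffun pt -> {set I}}) := (\sum_x #|A x| ^ 2)%N.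
case: (@arg_maxnP _ A0 orb pot or0) => A /orbP orA maxA.
exists A => // y t; set B := [set j | _].
pose A' : {ffun pt -> {set I}} := [ffun x => if x == y then A y :|: B
  else [set j in A x | ~~ ((j \in B) && (flip x j == y))]].
have flipN x j : (flip x j == x) = false.
  by apply/negP => /eqP /ffunP /(_ j); rewrite flipE; case: (x j).
have or' : orb A'.
  apply/orbP => x j.
  have base : ((j \in A' y) + (j \in A' (flip y j)) = viol f y j)%N.
    rewrite !ffunE eqxx flipN !inE flipK eqxx andbT; have := orA y j.
    case: (viol f y j); case: (j \in A y); case: (j \in A (flip y j)) => //= _; by [|case: (_ <= _)%N].
  have [->//|xy] := eqVneq x y.
  have [E|fxy] := eqVneq (flip x j) y.
    by rewrite -(flipK j x) E flipK viol_flip addnC.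
  rewrite !ffunE (negbTE xy) (negbTE fxy) !inE flipK (negbTE xy) (negbTE fxy).
  by rewrite !andbF !andbT orA.
have := maxA _ or'; rewrite /pot /geq /= (bigD1 y) //= [leqRHS](bigD1 y) //=.
have -> : (#|A' y| = #|A y| + #|B|)%N.
  rewrite ffunE eqxx -cardsUI (_ : A y :&: B = set0) ?cards0 ?addn0 //.
  apply/setP => j; rewrite !inE; have := orA y j.
  by case: (j \in A y) => //; case: (j \in A (flip y j)); case: viol.
(* A neighbour of out-degree at most [t] loses at most [2 * t], while [y] gains at least [#|B| ^ 2];
   maximality then forces [#|B| <= 2 * t]. *)
have others : (\sum_(x | x != y) #|A x| ^ 2
    <= \sum_(x | x != y) #|A' x| ^ 2 + 2 * t * #|B|)%N.
  apply: (@leq_trans (\sum_(x | x != y) (#|A' x| ^ 2 + 2 * t * (x \in flip y @: B)))).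
    apply: leq_sum => x xy; rewrite ffunE (negbTE xy).
    have [/imsetP [j jB ->]|xN] := boolP (x \in _).
      rewrite muln1.
      have -> : [set k in A (flip y j) | ~~ ((k \in B) && (flip (flip y j) k == y))]
          = A (flip y j) :\ j.
        apply/setP => k; rewrite !inE andbC; have [->|kj] := eqVneq k j.
          by move: jB; rewrite inE => ->; rewrite flipK eqxx.
        suff -> : (flip (flip y j) k == y) = false by rewrite andbF.
        apply/negP => /eqP /ffunP /(_ k); rewrite flipE /flip setc_neq //.
        by case: (y k).
      move: jB; rewrite inE (cardsD1 j (A (flip y j))) => /andP [-> /=].
      by move: #|_ :\ _| => a; nia.
    rewrite muln0 addn0 leq_exp2r //; apply: subset_leq_card.
    apply/subsetP => j jA; rewrite inE jA; apply/negP => /andP [jB /eqP E].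
    by move/negP: xN; apply; apply/imsetP; exists j; rewrite // -E flipK.
  rewrite big_split /= leq_add2l -big_distrr /= leq_mul2l; apply/orP; right.
  rewrite -(card_imset _ (flip_inj (x := y))) -sum1_card.
  rewrite [leqRHS]big_mkcond [leqLHS]big_mkcond /=.
  by apply: leq_sum => x _; case: (x != y); case: (x \in _).
move: others; set U := (\sum_(x | _) _)%N; set W := (\sum_(x | _) _)%N.
move: #|B| #|A y| => s a; nia.
Qed.

End Orientation.

Lemma pigeonhole_sum (R : realType) (J : finType) (t : J -> R) (eta : R) :
  (0 < #|J|)%N -> eta <= \sum_j t j -> exists j, eta <= #|J|%:R * t j.
Proof.
move=> J0 h; have [/existsP //|/existsPn none] := boolP [exists j, eta <= #|J|%:R * t j].
have J0' : 0 < #|J|%:R :> R by rewrite ltr0n.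
have /card_gt0P [j0 _] := J0.
suff : #|J|%:R * \sum_j t j < #|J|%:R * eta by rewrite ltr_pM2l // ltNge h.
have -> : #|J|%:R * eta = \sum_(j : J) eta by rewrite sumr_const mulr_natl.
rewrite mulr_sumr; apply: ltr_sum => [|j _].
  by apply/hasP; exists j0; rewrite ?mem_index_enum.
by rewrite ltNge none.
Qed.

(** * Dyadic levels of the out-degree *)

Section Levels.
Variables (R : realType) (I : finType).
Local Notation pt := (pt I).

Definition level (f : pt -> bool) (A : pt -> {set I}) (k : nat) (b : bool) (x : pt) :=
  (f x == b) && (2 ^ k <= #|A x| < 2 ^ k.+1)%N.

(** Pigeonhole over the [2 * l] classes given by the dyadic size of [A x] and the value [f x]: a
    point with nonempty [A x] lies in one of them, where [#|A x|] is at most [2 * 2 ^ k]. *)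
Lemma heavy_level (f : pt -> bool) (A : pt -> {set I}) (l : nat) (eta : R) :
  (0 < l)%N -> (#|I| < 2 ^ l)%N -> eta <= avg (fun x => Num.sqrt #|A x|%:R) ->
  exists (k : nat) (b : bool),
    eta <= (2 * l)%:R * (avg (fun x => (level f A k b x)%:R) * Num.sqrt (2 * 2 ^+ k)).
Proof.
move=> l0 Il h.
pose t (kb : 'I_l * bool) :=
  avg (fun x => (level f A kb.1 kb.2 x)%:R) * Num.sqrt (2 * 2 ^+ kb.1) : R.
have J0 : (0 < #|{: 'I_l * bool}|)%N by rewrite card_prod card_ord card_bool muln_gt0 l0.
have [|[k b] /= hkb] := @pigeonhole_sum R _ t eta J0; last first.
  by exists k, b; move: hkb; rewrite card_prod card_ord card_bool mulnC.
apply: le_trans h _.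
have -> : \sum_kb t kb = avg (fun x =>
    \sum_(kb : 'I_l * bool) Num.sqrt (2 * 2 ^+ kb.1) * (level f A kb.1 kb.2 x)%:R).
  by rewrite avg_sum; apply: eq_bigr => kb _; rewrite avgZ mulrC.
apply: le_avg => x.
have [->|Ax] := posnP #|A x|.
  by rewrite sqrtr0 sumr_ge0 // => kb _; rewrite mulr_ge0 ?sqrtr_ge0 ?ler0n.
have kl : (trunc_log 2 #|A x| < l)%N.
  rewrite -(ltn_exp2l _ _ (ltnSn 1)); apply: leq_ltn_trans (trunc_logP _ Ax) _ => //.
  by apply: leq_ltn_trans (max_card _) Il.
have /= bnd := trunc_log_bounds (ltnSn 1) Ax.
rewrite (bigD1 (Ordinal kl, f x)) //= /level eqxx bnd mulr1.
apply: ler_wpDr.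
  by rewrite sumr_ge0 // => kb _; rewrite mulr_ge0 ?sqrtr_ge0 ?ler0n.
apply: ler_wsqrtr; rewrite -exprS -natrX ler_nat ltnW //.
by case/andP: bnd.
Qed.

End Levels.

(** * Random upward jumps *)

Section Masks.
Variables (R : realType) (I : finType).
Local Notation pt := (pt I).
Implicit Types (x y m : pt) (i j : I) (s : seq I).

Definition mask_mass (q : R) m : R := \prod_j (if m j then q else 1 - q).

Definition mask_avg (q : R) (G : pt -> R) : R := \sum_m mask_mass q m * G m.

Variable q : R.
Hypotheses (q0 : 0 <= q) (q1 : q <= 1).

Lemma mask_mass_ge0 m : 0 <= mask_mass q m.
Proof. by apply: prodr_ge0 => j _; case: (m j) => //; rewrite subr_ge0. Qed.

Lemma mask_mass_sum1 : \sum_m mask_mass q m = 1.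
Proof.
rewrite /mask_mass -(bigA_distr_bigA (fun=> fun b : bool => if b then q else 1 - q)).
by rewrite big1 // => j _; rewrite big_bool /=; ring.
Qed.

Lemma mask_avg_const c : mask_avg q (fun=> c) = c.
Proof. by rewrite /mask_avg -mulr_suml mask_mass_sum1 mul1r. Qed.

Lemma eq_mask_avg F G : F =1 G -> mask_avg q F = mask_avg q G.
Proof. by move=> h; apply: eq_bigr => m _; rewrite h. Qed.

Lemma le_mask_avg F G : (forall m, F m <= G m) -> mask_avg q F <= mask_avg q G.
Proof. by move=> h; apply: ler_sum => m _; apply: ler_wpM2l (h m); exact: mask_mass_ge0. Qed.

Lemma mask_avgD F G : mask_avg q (fun m => F m + G m) = mask_avg q F + mask_avg q G.
Proof. by rewrite /mask_avg -big_split; apply: eq_bigr => m _; rewrite mulrDr. Qed.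

Lemma mask_avgB F G : mask_avg q (fun m => F m - G m) = mask_avg q F - mask_avg q G.
Proof. by rewrite /mask_avg -sumrB; apply: eq_bigr => m _; rewrite mulrBr. Qed.

Lemma mask_avgZ c F : mask_avg q (fun m => c * F m) = c * mask_avg q F.
Proof. by rewrite /mask_avg mulr_sumr; apply: eq_bigr => m _; rewrite mulrCA. Qed.

Lemma mask_avg_sum (J : finType) (P : pred J) (F : J -> pt -> R) :
  mask_avg q (fun m => \sum_(j | P j) F j m) = \sum_(j | P j) mask_avg q (F j).
Proof.
by rewrite /mask_avg exchange_big; apply: eq_bigr => m _; rewrite mulr_sumr.
Qed.

Lemma mask_avg_ge0 F : (forall m, 0 <= F m) -> 0 <= mask_avg q F.
Proof. by move=> h; rewrite -(mask_avg_const 0); exact: le_mask_avg. Qed.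

Lemma mask_avg_coord i G :
  mask_avg q G =
  mask_avg q (fun m => (1 - q) * G (setc m i false) + q * G (setc m i true)).
Proof.
pose rest m := \prod_(j | j != i) (if m j then q else 1 - q).
have massE m b : mask_mass q (setc m i b) = (if b then q else 1 - q) * rest m.
  rewrite /mask_mass (bigD1 i) //= setcE; congr (_ * _).
  by apply: eq_bigr => j ji; rewrite setc_neq.
have avgE F : mask_avg q F = #|{: pt}|%:R * avg (fun m => mask_mass q m * F m).
  rewrite /avg mulVKf // pnatr_eq0 -lt0n; exact: card_pt_gt0.
rewrite !avgE; congr (_ * _); rewrite (avg_coord i) [RHS](avg_coord i).
apply: eq_avg => m; rewrite !massE !setcK /=; ring.
Qed.

Definition join s x m : pt := [ffun j => x j || (m j && (j \in s))].

Lemma join_setc_false i s x m : i \notin s ->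
  join (i :: s) x (setc m i false) = join s x m.
Proof.
move=> is_; apply/ffunP => j; rewrite !ffunE inE.
by have [->|] := eqVneq j i; rewrite //= (negbTE is_) andbF.
Qed.

Lemma join_setc_true i s x m : i \notin s ->
  join (i :: s) x (setc m i true) = setc (join s x m) i true.
Proof.
move=> is_; apply/ffunP => j; rewrite !ffunE inE.
by have [->|] := eqVneq j i; rewrite //= orbT.
Qed.

Lemma mask_avg_join i s x (h : pt -> R) : i \notin s ->
  mask_avg q (fun m => h (join (i :: s) x m)) =
  mask_avg q (fun m => (1 - q) * h (join s x m) + q * h (setc (join s x m) i true)).
Proof.
move=> is_; rewrite (mask_avg_coord i); apply: eq_mask_avg => m.
by rewrite join_setc_false // join_setc_true.
Qed.

(** Density, relative to the uniform measure, of [join s x m] for uniform [x] and a mask of rate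
    [q]: a coordinate in [s] is 1 with probability (1 + q) / 2. *)
Definition tilt s x : R := \prod_(i <- s) (if x i then 1 + q else 1 - q).

Lemma tilt_ge0 s x : 0 <= tilt s x.
Proof.
apply: prodr_ge0 => i _; case: (x i); last by rewrite subr_ge0.
by rewrite addr_ge0.
Qed.

Lemma tilt_setc s x i b : i \notin s -> tilt s (setc x i b) = tilt s x.
Proof.
move=> is_; apply: eq_big_seq => j js; rewrite setc_neq //.
by apply: contraNneq is_ => <-.
Qed.

Lemma avg_join s (h : pt -> R) : uniq s ->
  avg (fun x => mask_avg q (fun m => h (join s x m))) = avg (fun x => tilt s x * h x).
Proof.
elim: s h => [|i s IH] h /=.
  move=> _; apply: eq_avg => x; rewrite /tilt big_nil mul1r -[RHS]mask_avg_const.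
  by apply: eq_mask_avg => m; congr h; apply/ffunP => j; rewrite ffunE andbF orbF.
move=> /andP [is_ us].
rewrite (eq_avg (G := fun x => mask_avg q (fun m =>
  (1 - q) * h (join s x m) + q * h (setc (join s x m) i true)))); last first.
  by move=> x; rewrite mask_avg_join.
rewrite (IH (fun x => (1 - q) * h x + q * h (setc x i true))) //.
rewrite (avg_coord i) [RHS](avg_coord i); apply: eq_avg => x.
rewrite /tilt !big_cons -!/(tilt _ _) !tilt_setc // !setcE !setcK; lra.
Qed.

(** The first-order terms cancel when the two bounds are averaged, which leaves the factor 1 + (r
    q)^2 per coordinate in [avg_tilt_exp]. *)
Lemma exprD1_quad (r : nat) : r%:R * q <= 1 ->
  (1 + q) ^+ r <= 1 + r%:R * q + (r%:R * q) ^+ 2 /\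
  (1 - q) ^+ r <= 1 - r%:R * q + (r%:R * q) ^+ 2.
Proof.
elim: r => [|r IH] h; first by rewrite !expr0 mul0r expr0n /=; lra.
have hr : r%:R * q <= 1 by apply: le_trans h; rewrite ler_wpM2r // ler_nat.
have [h1 h2] := IH hr; rewrite !exprS -natr1.
have r0 : 0 <= r%:R :> R by rewrite ler0n.
have rq0 : 0 <= r%:R * q by rewrite mulr_ge0.
split.
  apply: (@le_trans _ _ ((1 + q) * (1 + r%:R * q + (r%:R * q) ^+ 2))).
    by rewrite ler_wpM2l // addr_ge0.
  rewrite -subr_ge0; set c := (X in 0 <= X).
  have -> : c = q ^+ 2 * (r%:R * (1 - r%:R * q) + 1) by rewrite /c; ring.
  by rewrite mulr_ge0 ?sqr_ge0 // addr_ge0 // mulr_ge0 // subr_ge0.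
apply: (@le_trans _ _ ((1 - q) * (1 - r%:R * q + (r%:R * q) ^+ 2))).
  by rewrite ler_wpM2l // subr_ge0.
rewrite -subr_ge0; set c := (X in 0 <= X).
have -> : c = q ^+ 2 * (r%:R * (1 + r%:R * q) + 1) by rewrite /c; ring.
by rewrite mulr_ge0 ?sqr_ge0 // addr_ge0 // mulr_ge0 // addr_ge0.
Qed.

Lemma avg_tilt_exp s (r : nat) : uniq s -> r%:R * q <= 1 ->
  avg (fun x => tilt s x ^+ r) <= (1 + (r%:R * q) ^+ 2) ^+ size s.
Proof.
move=> + rq; have [h1 h2] := exprD1_quad rq.
elim: s => [_|i s IH /= /andP [is_ us]].
  rewrite (eq_avg (G := fun=> 1)) ?avg_pt_const // => x.
  by rewrite /tilt big_nil expr1n.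
rewrite exprS (avg_coord i).
apply: le_trans (ler_wpM2l _ (IH us)); last by rewrite addr_ge0 ?sqr_ge0.
rewrite -avgZ; apply: le_avg => x.
rewrite /tilt !big_cons -!/(tilt _ _) !tilt_setc // !setcE !exprMn.
have := exprn_ge0 r (tilt_ge0 s x); set t := tilt s x ^+ r => t0.
have -> : ((1 - q) ^+ r * t + (1 + q) ^+ r * t) / 2
  = ((1 - q) ^+ r + (1 + q) ^+ r) / 2 * t by lra.
apply: ler_wpM2r => //; lra.
Qed.

End Masks.

Lemma exprD1_le2 (R : realType) (delta : R) (n : nat) :
  0 <= delta -> 2 * n%:R * delta <= 1 -> (1 + delta) ^+ n <= 2.
Proof.
move=> d0 h; suff : (1 + delta) ^+ n <= 1 + 2 * n%:R * delta by lra.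
elim: n h => [|n IH] h; first by rewrite expr0 mulr0 mul0r addr0.
have nd : 0 <= n%:R * delta by rewrite mulr_ge0.
have h' : 2 * n%:R * delta <= 1 by move: h; rewrite -natr1; nra.
rewrite exprS; apply: le_trans (ler_wpM2l _ (IH h')) _; first by rewrite addr_ge0.
rewrite -natr1; nra.
Qed.

(** * Stability of a function under random upward jumps *)

Section Persistence.
Variables (R : realType) (I : finType).
Local Notation pt := (pt I).
Variables (f : pt -> bool) (q : R) (r : nat).
Hypotheses (q0 : 0 <= q) (q1 : q <= 1) (r0 : (0 < r)%N).
Hypothesis rq : 2 * #|I|%:R * (r%:R * q) ^+ 2 <= 1.

Definition sens (f : pt -> bool) (x : pt) i := f (setc x i false) != f (setc x i true).

Definition total_influence (f : pt -> bool) : R :=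
  avg (fun x => \sum_i (sens f x i)%:R).

(** Change of measure: where the density t is at most 2 it costs a factor 2, and where t > 2 one has
    t <= 2 (t / 2)^r, whose mean is controlled by the [r]-th moment. *)
Lemma avg_tilt_le s (h : pt -> bool) : uniq s ->
  avg (fun x => tilt q s x * (h x)%:R) <= 2 * avg (fun x => (h x)%:R) + 4 / 2 ^+ r.
Proof.
move=> us.
have sI : (size s <= #|I|)%N by rewrite -(card_uniqP us) max_card.
have [->|s0] := eqVneq s [::].
  rewrite (eq_avg (G := fun x => (h x)%:R)); last first.
    by move=> x; rewrite /tilt big_nil mul1r.
  have : 0 <= avg (fun x => (h x)%:R) :> R by apply: avg_ge0 => x.
  have : 0 <= 4 / 2 ^+ r :> R by rewrite divr_ge0 ?exprn_ge0.
  lra.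
have I0 : 1 <= #|I|%:R :> R.
  by rewrite ler1n (leq_trans _ sI) // lt0n size_eq0.
have rq0 : 0 <= r%:R * q by rewrite mulr_ge0.
have rq1 : r%:R * q <= 1.
  rewrite -(@expr_le1 _ 2) //; move: rq (sqr_ge0 (r%:R * q)).
  by move: (_ ^+ 2) => t; nra.
have mom : avg (fun x => tilt q s x ^+ r) <= 2.
  apply: le_trans (avg_tilt_exp q0 q1 us rq1) _.
  apply: exprD1_le2; rewrite ?sqr_ge0 //; apply: le_trans rq.
  by rewrite ler_wpM2r ?sqr_ge0 // ler_pM2l ?ltr0n // ler_nat.
apply: (@le_trans _ _ (2 * avg (fun x => (h x)%:R)
    + (2 / 2 ^+ r) * avg (fun x => tilt q s x ^+ r))); last first.
  rewrite lerD2l; have : 0 <= 2 / 2 ^+ r :> R by rewrite divr_ge0 ?exprn_ge0.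
  nra.
rewrite -!avgZ -avgD; apply: le_avg => x.
have t0 := tilt_ge0 q0 q1 s x; set t := tilt q s x in t0 *.
have P0 : 0 <= 2 / 2 ^+ r * t ^+ r by rewrite mulr_ge0 ?divr_ge0 ?exprn_ge0.
have [t2|t2] := leP t 2; first by case: (h x) => /=; lra.
suff : t <= 2 / 2 ^+ r * t ^+ r by case: (h x) => /=; lra.
case: r r0 => // r' _; rewrite !exprS.
have -> : 2 / (2 * 2 ^+ r') * (t * t ^+ r') = t * (t / 2) ^+ r'.
  by rewrite expr_div_n; field; rewrite expf_neq0 // pnatr_eq0.
rewrite ler_peMr // exprn_ege1 // ler_pdivlMr; lra.
Qed.

(** Let the coordinates join one at a time. Direction [i] is raised with probability [q] from a
    point distributed with density [tilt], and adds a disagreement only if [f] changes there;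
    [avg_tilt_le] returns to the uniform measure. *)
Lemma persistence_on s : uniq s ->
  avg (fun x => mask_avg q (fun m => (f x != f (join s x m))%:R))
  <= q * \sum_(i <- s) (avg (fun x => (sens f x i)%:R) + 4 / 2 ^+ r).
Proof.
elim: s => [_|i s IH /= /andP [is_ us]].
  rewrite big_nil mulr0 (eq_avg (G := fun=> 0)) ?avg_pt_const // => x.
  rewrite -[RHS](mask_avg_const I q); apply: eq_mask_avg => m.
  by rewrite (_ : join _ _ _ = x) ?eqxx //; apply/ffunP => j; rewrite ffunE andbF orbF.
rewrite big_cons mulrDr addrC.
pose h x := f x != f (setc x i true).
apply: (@le_trans _ _ (avg (fun x => mask_avg q (fun m =>
    (f x != f (join s x m))%:R + q * (h (join s x m))%:R)))).
  apply: le_avg => x; rewrite (mask_avg_join q x (fun y => (f x != f y)%:R)) //.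
  apply: le_mask_avg => // m; rewrite /h; set y := join s x m.
  by have := q0; case: (f x); case: (f y); case: (f _) => /=; lra.
rewrite (eq_avg (G := fun x => mask_avg q (fun m => (f x != f (join s x m))%:R)
    + q * mask_avg q (fun m => (h (join s x m))%:R))); last first.
  by move=> x; rewrite mask_avgD mask_avgZ.
rewrite avgD; apply: lerD; first exact: IH.
rewrite avgZ; apply: ler_wpM2l => //.
rewrite (avg_join q (fun y => (h y)%:R)) //.
(* [h] holds only at the lower end of a sensitive [i]-edge, so its mean is half that of [sens]; this
   absorbs the factor 2. *)
apply: le_trans (avg_tilt_le h us) _; rewrite lerD2r -avgZ.
rewrite (avg_coord i) [leRHS](avg_coord i); apply: le_avg => x.
rewrite /h /sens !setcK eqxx /=; lra.
Qed.

Definition joinp (x m : pt) : pt := [ffun j => x j || m j].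

Definition instability (y : pt) : R := mask_avg q (fun m => (f y != f (joinp y m))%:R).

Lemma persistence :
  avg instability <= q * (total_influence f + 4 * #|I|%:R / 2 ^+ r).
Proof.
have joinE x m : join (enum I) x m = joinp x m.
  by apply/ffunP => j; rewrite !ffunE mem_enum andbT.
have -> : avg instability
    = avg (fun x => mask_avg q (fun m => (f x != f (join (enum I) x m))%:R)).
  by apply: eq_avg => x; apply: eq_mask_avg => m; rewrite joinE.
apply: le_trans (persistence_on (enum_uniq I)) _; apply: ler_wpM2l => //.
rewrite /total_influence avg_sum big_split /= !big_enum /= lerD2l.
by rewrite sumr_const -[_ *+ _]mulr_natl mulrA [_ * 4]mulrC.
Qed.

Section UpTest.
Variables (V : pred pt) (A : pt -> {set I}) (d : nat).
Hypothesis Vf : forall x, V x -> f x.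
Hypothesis Aviol : forall x j, V x -> j \in A x -> viol f x j.
Hypothesis Acard : forall x, V x -> (d <= #|A x| <= 2 * d)%N.
Hypothesis indeg : forall y,
  (#|[set j | V (flip y j) && (j \in A (flip y j))]| <= 4 * d)%N.
Hypothesis dq : 4 * d%:R * q <= 1.

Lemma mask_avg_mem (j : I) : mask_avg q (fun m : pt => (m j)%:R) = q.
Proof.
rewrite (mask_avg_coord q j) -[RHS](mask_avg_const I q).
by apply: eq_mask_avg => m; rewrite !setcE /=; lra.
Qed.

Lemma mask_avg_mem2 (j k : I) :
  mask_avg q (fun m : pt => (m j && m k)%:R) <= q ^+ 2 + (j == k)%:R * q.
Proof.
have [<-|jk] := eqVneq j k.
  rewrite (eq_mask_avg q (G := fun m => (m j)%:R)) ?mask_avg_mem.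
    by rewrite mul1r lerDr sqr_ge0.
  by move=> m; rewrite andbb.
rewrite mul0r addr0 (mask_avg_coord q j).
rewrite (eq_mask_avg q (G := fun m => q * (m k)%:R)) ?mask_avgZ ?mask_avg_mem //.
by move=> m; rewrite !setcE /= setc_neq 1?eq_sym // mulr0 add0r.
Qed.

(* With [c] the number of decreasing directions in the mask, the indicator of
   [f (x \/ m) = 0] is at least [2c - c^2 - c [f (x \/ m) = 1]]. *)
Lemma up_test_at (x : pt) : V x ->
  q * d%:R / 2 - q * \sum_(j in A x) instability (flip x j)
  <= mask_avg q (fun m => (~~ f (joinp x m))%:R).
Proof.
move=> Vx; set a := #|A x|.
pose c (m : pt) : nat := (\sum_(j in A x) m j)%N.
have cE m : (c m)%:R = \sum_(j in A x) (m j)%:R :> R by rewrite natr_sum.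
have avg_c : mask_avg q (fun m => (c m)%:R) = q * a%:R.
  rewrite (eq_mask_avg q cE) mask_avg_sum.
  rewrite (eq_bigr (fun=> q)) => [|j _]; last exact: mask_avg_mem.
  by rewrite sumr_const mulr_natr.
have avg_c2 : mask_avg q (fun m => (c m)%:R ^+ 2) <= q ^+ 2 * a%:R ^+ 2 + q * a%:R.
  rewrite (eq_mask_avg q (G := fun m =>
    \sum_(j in A x) \sum_(k in A x) (m j && m k)%:R)); last first.
    move=> m; rewrite cE expr2 mulr_suml; apply: eq_bigr => j _.
    by rewrite mulr_sumr; apply: eq_bigr => k _; rewrite -natrM mulnb.
  rewrite mask_avg_sum.
  apply: (@le_trans _ _ (\sum_(j in A x) (q ^+ 2 * a%:R + q))).
    apply: ler_sum => j jA; rewrite mask_avg_sum.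
    apply: (@le_trans _ _ (\sum_(k in A x) (q ^+ 2 + (j == k)%:R * q))).
      by apply: ler_sum => k _; exact: mask_avg_mem2.
    rewrite big_split /= sumr_const (bigD1 j) //= eqxx mul1r big1 ?addr0 ?mulr_natr //.
    by move=> k /andP [_ kj]; rewrite eq_sym (negbTE kj) mul0r.
  by rewrite sumr_const -[_ *+ _]mulr_natr mulrDl -mulrA -expr2.
(* Once [j] is in the mask, jumping from [x] is jumping from [flip x j], where [f] is 0; reaching
   the value 1 is then an instability of that point. *)
have avg_cf : mask_avg q (fun m => (c m)%:R * (f (joinp x m))%:R)
    = q * \sum_(j in A x) instability (flip x j).
  rewrite mulr_sumr (eq_mask_avg q (G := fun m =>
    \sum_(j in A x) (m j)%:R * (f (joinp x m))%:R)); last first.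
    by move=> m; rewrite cE mulr_suml.
  rewrite mask_avg_sum; apply: eq_bigr => j jA.
  have v := Aviol Vx jA.
  rewrite (mask_avg_coord q j) /instability -mask_avgZ; apply: eq_mask_avg => m.
  rewrite !setcE mul0r mulr0 add0r mul1r (viol_end v) (Vf Vx) /=.
  congr (q * (nat_of_bool _)%:R).
  have -> : joinp x (setc m j true) = joinp (flip x j) m.
    apply/ffunP => k; rewrite !ffunE; have [->|//] := eqVneq k j.
    by rewrite (viol_coord v) (Vf Vx) orbT.
  by case: (f _).
have /andP [da ad] := Acard Vx.
have qd0 : 0 <= q * d%:R by rewrite mulr_ge0.
have qa : q * d%:R <= q * a%:R by rewrite ler_wpM2l // ler_nat.
(* This makes the main term 2 q a - (q^2 a^2 + q a) at least q a / 2. *)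
have qa2 : q * a%:R <= 1 / 2.
  have : q * a%:R <= q * (2 * d)%:R by rewrite ler_wpM2l // ler_nat.
  by have := dq; rewrite natrM; lra.
apply: (@le_trans _ _ (mask_avg q (fun m =>
    2 * (c m)%:R - (c m)%:R ^+ 2 - (c m)%:R * (f (joinp x m))%:R))).
  rewrite !mask_avgB mask_avgZ avg_c avg_cf lerD2r; nra.
apply: le_mask_avg => // m.
case: (f _) => /=; last by rewrite mulr0 subr0 -subr_ge0 (_ : _ - _ = ((c m)%:R - 1) ^+ 2) ?sqr_ge0 //; ring.
rewrite mulr1; case: (c m) => [|n]; first by rewrite expr0n /=; lra.
have : 0 <= n%:R :> R by rewrite ler0n.
by rewrite -natr1; nra.
Qed.

(** Sum [up_test_at] over [V]: by [indeg], each [y] occurs as an endpoint [flip x j] at most [4 * d]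
    times, so the total loss is controlled by the mean instability. *)
Lemma up_test_success :
  q * d%:R * (avg (fun x => (V x)%:R) / 2 - 4 * avg instability)
  <= avg (fun x => mask_avg q (fun m => (f x && ~~ f (joinp x m))%:R)).
Proof.
have in_le : avg (fun x => (V x)%:R * \sum_(j in A x) instability (flip x j))
    <= 4 * d%:R * avg instability.
  pose W x j := (V x && (j \in A x))%:R : R.
  have -> : avg (fun x => (V x)%:R * \sum_(j in A x) instability (flip x j))
      = avg (fun x => \sum_j W x j * instability (flip x j)).
    apply: eq_avg => x; rewrite big_mkcond mulr_sumr; apply: eq_bigr => j _.
    by rewrite /W; case: (V x); case: (j \in A x); rewrite ?mul0r ?mul1r.
  rewrite avg_sum (eq_bigr (fun j => avg (fun y => W (flip y j) j * instability y))).
    rewrite -avg_sum -avgZ; apply: le_avg => y; rewrite -mulr_suml.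
    apply: ler_wpM2r; first by apply: mask_avg_ge0 => // m.
    rewrite -natrM; apply: le_trans (_ : _ <= #|[set j | V (flip y j) && (j \in A (flip y j))]|%:R) _.
      rewrite -sum1_card natr_sum [leRHS]big_mkcond; apply: ler_sum => j _.
      by rewrite inE /W; case: (_ && _).
    by rewrite ler_nat.
  by move=> j _; rewrite -[RHS](avg_flip j); apply: eq_avg => x; rewrite flipK.
apply: (@le_trans _ _ (avg (fun x => (q * d%:R / 2) * (V x)%:R
   - q * ((V x)%:R * \sum_(j in A x) instability (flip x j))))).
  rewrite avgB !avgZ.
  have := ler_wpM2l q0 in_le; lra.
apply: le_avg => x; have [Vx|nVx] := boolP (V x); last first.
  rewrite mul0r !mulr0 subr0; apply: mask_avg_ge0 => // m.
rewrite mulr1 mul1r; apply: le_trans (up_test_at Vx) _.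
by apply: le_mask_avg => // m; rewrite (Vf Vx).
Qed.

End UpTest.

End Persistence.

(** * Pair tests for the uniform measure *)

Section Influence.
Variables (R : realType) (I : finType).
Local Notation pt := (pt I).
Implicit Types (f : pt -> bool) (x : pt).

Definition neg_influence f : R := avg (fun x => \sum_i (viol f x i)%:R).

Let chi x i : R := if x i then 1 else -1.

Lemma avg_sum_chi_sq : avg (fun x => (\sum_i chi x i) ^+ 2) = #|I|%:R.
Proof.
rewrite (eq_avg (G := fun x => \sum_i \sum_k chi x i * chi x k)); last first.
  by move=> x; rewrite expr2 mulr_suml; apply: eq_bigr => i _; rewrite mulr_sumr.
rewrite avg_sum -sum1_card natr_sum; apply: eq_bigr => i _.
rewrite avg_sum (bigD1 i) //= big1 ?addr0.
  rewrite -[RHS](avg_pt_const I); apply: eq_avg => x.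
  by rewrite /chi; case: (x i); rewrite ?mulr1 ?mulrNN ?mulr1.
move=> k ki; rewrite (avg_coord i) -[RHS](avg_pt_const I); apply: eq_avg => x.
by rewrite /chi !setcE !setc_neq //=; case: (x k); lra.
Qed.

(** The signed influence is the mean of 2 f(x) times the sum S of the signs [chi x i]. With r the
    square root of the dimension, S <= S^2 / (2 r) + r / 2, and orthogonality of the signs gives the
    mean of S^2. *)
Lemma avg_sum_grad f :
  avg (fun x => \sum_i ((f (setc x i true))%:R - (f (setc x i false))%:R))
  <= 2 * Num.sqrt #|I|%:R :> R.
Proof.
have [I0|I0] := posnP #|I|.
  rewrite (eq_avg (G := fun=> 0)) ?avg_pt_const ?mulr_ge0 ?sqrtr_ge0 // => x.
  by rewrite big1 // => i; have := fintype0 i I0.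
set r := Num.sqrt _; have r0 : 0 < r by rewrite sqrtr_gt0 ltr0n.
have -> : avg (fun x => \sum_i ((f (setc x i true))%:R - (f (setc x i false))%:R))
    = 2 * avg (fun x => (f x)%:R * \sum_i chi x i).
  rewrite avg_sum (eq_avg (F := fun x => (f x)%:R * _)
    (G := fun x => \sum_i (f x)%:R * chi x i)) ?avg_sum ?mulr_sumr.
    apply: eq_bigr => i _; rewrite [in RHS](avg_coord i) -avgZ; apply: eq_avg => x.
    by rewrite /chi !setcE; lra.
  by move=> x; rewrite mulr_sumr.
rewrite ler_pM2l ?ltr0n //.
apply: (@le_trans _ _ (avg (fun x => (2 * r)^-1 * (\sum_i chi x i) ^+ 2 + r / 2))).
  apply: le_avg => x; move: (\sum_i _) => S.
  have h : S <= (2 * r)^-1 * S ^+ 2 + r / 2.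
    rewrite -subr_ge0; set c := (X in 0 <= X).
    have -> : c = (2 * r)^-1 * (S - r) ^+ 2 by rewrite /c; field; rewrite gt_eqF.
    by apply: mulr_ge0; rewrite ?sqr_ge0 // invr_ge0; lra.
  have h' : 0 <= (2 * r)^-1 * S ^+ 2 + r / 2.
    apply: addr_ge0; last by lra.
    by apply: mulr_ge0; rewrite ?sqr_ge0 // invr_ge0; lra.
  by case: (f x); rewrite ?mul1r ?mul0r.
rewrite avgD avgZ avg_pt_const avg_sum_chi_sq.
have -> : #|I|%:R = r ^+ 2 :> R by rewrite sqrt_natE.
by rewrite le_eqVlt; apply/orP; left; apply/eqP; field; rewrite gt_eqF.
Qed.

(** In each direction [sens] is the signed difference plus twice [viol]. *)
Lemma total_le_neg_influence f :
  total_influence R f <= 2 * neg_influence f + 2 * Num.sqrt #|I|%:R.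
Proof.
apply: le_trans (lerD (lexx _) (avg_sum_grad f)).
rewrite -avgZ -avgD; apply: le_avg => x; rewrite mulr_sumr -big_split.
apply: ler_sum => i _; rewrite /sens /viol /=.
by case: (f _); case: (f _) => /=; lra.
Qed.

End Influence.

(** * Complementation of points and values *)

Section Dual.
Variables (R : realType) (I : finType).
Local Notation pt := (pt I).
Implicit Types (f : pt -> bool) (x : pt).

Definition compl x : pt := [ffun i => ~~ x i].
(** Turns points of value 0 into points of value 1 while decreasing edges stay decreasing, so that
    upward jumps suffice for levels of either value. *)
Definition dual f x := ~~ f (compl x).

Lemma complK : involutive compl.
Proof. by move=> x; apply/ffunP => i; rewrite !ffunE negbK. Qed.

Lemma compl_setc x i b : compl (setc x i b) = setc (compl x) i (~~ b).
Proof. by apply/ffunP => j; rewrite !ffunE; case: eqP. Qed.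

Lemma compl_flip x i : compl (flip x i) = flip (compl x) i.
Proof. by rewrite /flip compl_setc ffunE. Qed.

Lemma viol_dual f x j : viol (dual f) x j = viol f (compl x) j.
Proof. by rewrite /viol /dual !compl_setc negbK andbC. Qed.

Lemma avg_compl (F : pt -> R) : avg (fun x => F (compl x)) = avg F.
Proof. by rewrite (avg_bij F (inv_bij complK)). Qed.

Lemma total_influence_dual f : total_influence R (dual f) = total_influence R f.
Proof.
rewrite /total_influence -[RHS]avg_compl; apply: eq_avg => x.
apply: eq_bigr => i _; rewrite /sens /dual !compl_setc /=.
by case: (f _); case: (f _).
Qed.

End Dual.

Definition up_success (R : realType) (I : finType) (q : R) (f : pt I -> bool) : R :=
  avg (fun x => mask_avg q (fun m => (f x && ~~ f (joinp x m))%:R)).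

Definition edge_success (R : realType) (I : finType) (f : pt I -> bool) : R :=
  #|I|%:R^-1 * neg_influence R f.

(** * Success probability of pair tests under the uniform measure *)

Section UniformTest.
Variables (R : realType) (I : finType) (eps : R) (l : nat).
Local Notation pt := (pt I).
Hypotheses (I0 : (0 < #|I|)%N) (eps0 : 0 < eps) (eps1 : eps <= 1).
Hypothesis l_large : 4 * #|I|%:R / eps <= 2 ^+ l.

Let N : R := Num.sqrt #|I|%:R.

(** The jump rate meant for a level of density about 2^-t. The factor [N] keeps the instability
    small against that density; [l] allows moments of order [l] in [persistence]. *)
Definition scale (t : nat) : R := (2^-1) ^+ t / (80 * l%:R * N).

Lemma sqrt_card_ge1 : 1 <= N.
Proof. by rewrite -sqrtr1 ler_wsqrtr // ler1n. Qed.

Lemma two_exp_ge : 4 <= 2 ^+ l :> R.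
Proof.
apply: le_trans l_large; rewrite ler_pdivlMr //.
have h : 1 <= #|I|%:R :> R by rewrite ler1n.
by have := eps1; lra.
Qed.

Lemma l_gt0 : (0 < l)%N.
Proof. by case: l two_exp_ge => //; rewrite expr0; lra. Qed.

Lemma card_over_two_exp : 4 * #|I|%:R / 2 ^+ l <= eps.
Proof.
have P0 : 0 < 2 ^+ l :> R by rewrite exprn_gt0.
by move: l_large; rewrite !ler_pdivrMr // [2 ^+ l * _]mulrC.
Qed.

Section Level.
Variables (f : pt -> bool) (V : pred pt) (A : pt -> {set I}) (d t : nat).
Hypothesis Vf : forall x, V x -> f x.
Hypothesis Aviol : forall x j, V x -> j \in A x -> viol f x j.
Hypothesis Acard : forall x, V x -> (d <= #|A x| <= 2 * d)%N.
Hypothesis indeg : forall y,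
  (#|[set j | V (flip y j) && (j \in A (flip y j))]| <= 4 * d)%N.
Hypothesis inf_small : total_influence R f <= 4 * N.
Let sigma : R := avg (fun x => (V x)%:R).
Hypotheses (t_le : (2^-1) ^+ t <= sigma) (t_ge : sigma / 2 <= (2^-1) ^+ t).

Lemma level_success :
  sigma ^+ 2 * d%:R / (640 * l%:R * N) <= up_success (scale t) f.
Proof.
have N1 := sqrt_card_ge1; have l1 : 1 <= l%:R :> R by rewrite ler1n l_gt0.
pose u : R := (2^-1) ^+ t; set q := scale t.
have [ul ug] : u <= sigma /\ sigma / 2 <= u by [].
have u0 : 0 < u by rewrite exprn_gt0 // invr_gt0.
have sigma1 : sigma <= 1.
  by rewrite -[leRHS](avg_pt_const I); apply: le_avg => x; rewrite lern1 leq_b1.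
have d0 : 0 <= d%:R :> R by [].
have lN : 1 <= l%:R * N by nra.
have qE : q * (l%:R * N) = u / 80.
  by rewrite /q /scale -/u; field; rewrite !gt_eqF //; lra.
have q0 : 0 <= q by rewrite divr_ge0 ?ltW //; nra.
have q1 : q <= 1 by nra.
have qN : q * N <= u / 80 by nra.
have rq : 2 * #|I|%:R * (l%:R * q) ^+ 2 <= 1.
  have -> : #|I|%:R = N ^+ 2 :> R by rewrite sqrt_natE.
  have -> : 2 * N ^+ 2 * (l%:R * q) ^+ 2 = 2 * (q * (l%:R * N)) ^+ 2 by ring.
  rewrite qE; nra.
have sd : sigma * d%:R <= 4 * N.
  apply: le_trans inf_small; rewrite mulrC /sigma -avgZ; apply: le_avg => x.
  have [Vx|_] := boolP (V x); last by rewrite mulr0 sumr_ge0.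
  rewrite mulr1; apply: (@le_trans _ _ #|A x|%:R).
    by rewrite ler_nat; case/andP: (Acard Vx).
  rewrite -sum1_card natr_sum big_mkcond; apply: ler_sum => j _.
  case: ifP => // jA; have := Aviol Vx jA; rewrite /viol /sens.
  by case: (f _); case: (f _).
have dq : 4 * d%:R * q <= 1.
  have : u * d%:R <= 4 * N by apply: le_trans sd; rewrite ler_wpM2r.
  have N0 : 0 <= N by lra.
  move=> ud; rewrite -(@ler_pM2r _ (l%:R * N)) ?mul1r; last by lra.
  have -> : 4 * d%:R * q * (l%:R * N) = 4 * d%:R * (u / 80) by rewrite -qE; ring.
  have : N <= l%:R * N by rewrite ler_peMl.
  lra.
(* Moments of order [l] make the error term 4 |I| / 2^l at most [eps], hence at most [N]; the
   influence contributes [4 * N]. *)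
have pers := persistence f q0 q1 l_gt0 rq.
have {}pers : avg (instability f q) <= 5 * (u / 80).
  apply: le_trans pers _; apply: (@le_trans _ _ (q * (5 * N))); last by nra.
  rewrite ler_wpM2l //; have := card_over_two_exp; move: inf_small eps1; lra.
have := up_test_success q0 q1 Vf Aviol Acard indeg dq.
rewrite -/sigma -/(up_success q f) => h; apply: le_trans h.
(* The instability is at most u / 16 <= sigma / 16, so half of the main term survives. *)
have hs : sigma / 4 <= sigma / 2 - 4 * avg (instability f q) by lra.
have q_ge : sigma / (160 * (l%:R * N)) <= q.
  by rewrite ler_pdivrMr; [rewrite mulrCA qE; lra | lra].
have -> : sigma ^+ 2 * d%:R / (640 * l%:R * N)
    = sigma / (160 * (l%:R * N)) * d%:R * (sigma / 4).
  by field; rewrite !gt_eqF //; lra.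
have s0 : 0 <= sigma by lra.
apply: ler_pM => //; last by rewrite ler_wpM2r.
  by rewrite mulr_ge0 // divr_ge0 //; lra.
by lra.
Qed.

End Level.

Lemma uniform_success (f : pt -> bool) :
  (forall g, (forall j, mono_in j g) -> eps <= dist R f g) ->
  N^-1 <= edge_success R f \/
  exists t b, (t < 7 * l)%N /\
    eps ^+ 2 / (512 * 640 * l%:R ^+ 5 * N)
      <= up_success (scale t) (if b then f else dual f).
Proof.
move=> far; have N1 := sqrt_card_ge1; have e0 := eps0; have e1 := eps1.
have NE : #|I|%:R = N ^+ 2 :> R by rewrite sqrt_natE.
have [inf_big|inf_small] := leP (4 * N) (total_influence R f).
  left; rewrite /edge_success NE.
  have := total_le_neg_influence R f; rewrite -/N => h.
  have hn : N <= neg_influence R f by lra.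
  have -> : N^-1 = (N ^+ 2)^-1 * N by field; rewrite gt_eqF //; lra.
  by rewrite ler_wpM2l // invr_ge0 sqr_ge0.
right; have [A orA balA] := balanced_orientation f.
have l1 : 1 <= l%:R :> R by rewrite ler1n l_gt0.
(* The choice of [l] makes |I| / 2^l at most eps / 4, so the Talagrand term keeps at least 3/4 of
   [eps]. *)
have Phi_ge : eps / (8 * l%:R) <= avg (fun x => Num.sqrt #|A x|%:R).
  have := directed_talagrand (fun j => orientation_covers orA) l far.
  set Phi := avg _; have := card_over_two_exp.
  rewrite -[4 * _ / _]mulrA; move: (_ / 2 ^+ l) => z hz h.
  rewrite ler_pdivrMr; lra.
have Il : (#|I| < 2 ^ l)%N.
  rewrite -(ltr_nat R) natrX; have := card_over_two_exp.
  rewrite ler_pdivrMr ?exprn_gt0 // => h.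
  have : eps * 2 ^+ l <= 2 ^+ l by rewrite ler_piMl // exprn_ge0.
  have : 1 <= #|I|%:R :> R by rewrite ler1n.
  lra.
have [k [b]] := heavy_level f l_gt0 Il Phi_ge.
set V := level f A k b; set sigma := avg _; set d := 2 ^+ k => hsig.
have s0 : 0 <= sigma by apply: avg_ge0.
have s1 : sigma <= 1.
  by rewrite -[leRHS](avg_pt_const I); apply: le_avg => x; rewrite lern1 leq_b1.
have {}hsig : eps / (16 * l%:R ^+ 2) <= sigma * Num.sqrt (2 * d).
  move: hsig; rewrite natrM !ler_pdivrMr; [|nra|lra].
  by move: (sigma * _) => z; nra.
have lhs0 : 0 < eps / (16 * l%:R ^+ 2) by rewrite divr_gt0 //; nra.
have sgt0 : 0 < sigma.
  rewrite lt_def s0 andbT; apply: contraTneq hsig => ->.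
  by rewrite mul0r -ltNge.
have dI : (2 ^ k <= #|I|)%N.
  rewrite leqNgt; apply/negP => Ik; move: sgt0.
  rewrite /sigma (eq_avg (G := fun=> 0)) ?avg_pt_const ?ltxx // => x.
  rewrite /V /level leqNgt (leq_ltn_trans (max_card _) Ik) /= andbF //.
(* Squaring turns the Talagrand sum of the level into [sigma ^+ 2 * d], the quantity in
   [level_success]; 512 is 2 times 16 squared. *)
have sq : eps ^+ 2 / (512 * l%:R ^+ 4) <= sigma ^+ 2 * d.
  have : (eps / (16 * l%:R ^+ 2)) ^+ 2 <= (sigma * Num.sqrt (2 * d)) ^+ 2.
    rewrite ler_sqr // nnegrE; first exact: ltW.
    by rewrite mulr_ge0 ?sqrtr_ge0.
  rewrite [(sigma * _) ^+ 2]exprMn sqr_sqrtr ?mulr_ge0 ?exprn_ge0 // => h.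
  have -> : eps ^+ 2 / (512 * l%:R ^+ 4) = (eps / (16 * l%:R ^+ 2)) ^+ 2 / 2.
    by field; rewrite gt_eqF //; lra.
  have -> : sigma ^+ 2 * d = sigma ^+ 2 * (2 * d) / 2 by field.
  by rewrite ler_pM2r // invr_gt0.
(* A level this dense only needs the scales [t <= 6 * l], so the finite range [t < 7 * l]
   suffices. *)
have small : (2^-1) ^+ (6 * l) <= sigma.
  pose X : R := 2 ^+ l; have X4 : 4 <= X by exact: two_exp_ge.
  have lX : l%:R <= X by rewrite /X -natrX ler_nat ltnW // ltn_expl.
  have sqX : Num.sqrt (2 * d) <= X.
    rewrite -[X]ger0_norm; last by lra.
    rewrite -sqrtr_sqr; apply: ler_wsqrtr.
    have : d <= X by rewrite /d /X -!natrX ler_nat (leq_trans dI) // ltnW.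
    nra.
  have eX : 4 <= eps * X.
    have := card_over_two_exp; rewrite ler_pdivrMr ?exprn_gt0 // -/X.
    have : 1 <= #|I|%:R :> R by rewrite ler1n.
    lra.
  have h1 : eps <= 16 * l%:R ^+ 2 * (sigma * X).
    move: hsig; rewrite ler_pdivrMr; last by nra.
    move=> h; apply: le_trans h _; rewrite mulrC; apply: ler_wpM2l; first by nra.
    by rewrite ler_wpM2l.
  have l2 : l%:R ^+ 2 <= X ^+ 2 by rewrite ler_sqr // nnegrE; lra.
  have h2 : 4 <= 16 * X ^+ 4 * sigma.
    apply: le_trans eX _; apply: (@le_trans _ _ (16 * X ^+ 2 * (sigma * X) * X)).
      rewrite ler_wpM2r //; first by lra.
      apply: le_trans h1 _; rewrite ler_wpM2r ?ler_wpM2l //.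
      by rewrite mulr_ge0 //; lra.
    by rewrite le_eqVlt; apply/orP; left; apply/eqP; ring.
  rewrite mulnC exprM exprVn -/X exprVn -[leLHS]mul1r ler_pdivrMr; last first.
    by rewrite exprn_gt0 //; lra.
  have -> : sigma * X ^+ 6 = X ^+ 2 * (X ^+ 4 * sigma) by ring.
  have : 0 <= X ^+ 4 * sigma by rewrite mulr_ge0 // exprn_ge0 //; lra.
  have : 4 <= X ^+ 2 by nra.
  by move: h2; rewrite -mulrA; move: (X ^+ 2) (X ^+ 4 * sigma) => y z; nra.
(* The least such [t], so that 2^-t lies within a factor 2 of [sigma]. *)
have [t t_le t_min] : exists2 t, (2^-1) ^+ t <= sigma &
    forall t', (2^-1) ^+ t' <= sigma -> (t <= t')%N.
  have ex : exists t, (2^-1) ^+ t <= sigma by exists (6 * l)%N.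
  by exists (ex_minn ex); case: ex_minnP.
have t_ge : sigma / 2 <= (2^-1) ^+ t.
  case: t t_le t_min => [|t] t_le t_min; first by rewrite expr0; lra.
  have [/t_min|] := leP ((2^-1) ^+ t) sigma; first by rewrite ltnn.
  by rewrite exprS; lra.
exists t, b; split.
  by rewrite (leq_ltn_trans (t_min _ small)) // ltn_pmul2r // l_gt0.
have Acard x : V x -> (2 ^ k <= #|A x| <= 2 * 2 ^ k)%N.
  by move=> /andP [_ /andP [-> /ltnW]]; rewrite expnS.
have indeg y : (#|[set j | V (flip y j) && (j \in A (flip y j))]| <= 4 * 2 ^ k)%N.
  apply: (@leq_trans (2 * (2 * 2 ^ k))); last by rewrite mulnA.
  apply: leq_trans (balA y (2 * 2 ^ k)%N); apply: subset_leq_card.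
  by apply/subsetP => j; rewrite !inE => /andP [/Acard /andP [_ ->] ->].
apply: (@le_trans _ _ (sigma ^+ 2 * (2 ^ k)%:R / (640 * l%:R * N))).
  rewrite natrX -/d.
  have -> : eps ^+ 2 / (512 * 640 * l%:R ^+ 5 * N)
      = eps ^+ 2 / (512 * l%:R ^+ 4) / (640 * l%:R * N).
    by field; rewrite !gt_eqF //; lra.
  by rewrite ler_wpM2r // invr_ge0; nra.
case: b @V @sigma hsig s0 s1 sgt0 sq small t_le t_min t_ge Acard indeg => V sigma _ _ _ _ _ _ t_le _ t_ge Acard indeg.
  apply: (level_success (V := V) (A := A)) => //; last exact: ltW.
    by move=> x /andP [/eqP ->].
  by move=> x j _; exact: orientation_viol.
(* For [b] false the starting points have value 0: pass to [dual f] and complement both the level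
   and the orientation. *)
have sigmaE : sigma = avg (fun x => (V (compl x))%:R).
  by rewrite (avg_compl (fun x => (V x)%:R)).
rewrite sigmaE in t_le t_ge *.
apply: (level_success (V := fun x => V (compl x)) (A := fun x => A (compl x))) => //.
- by move=> x /andP [/eqP h _]; rewrite /dual h.
- by move=> x j _; rewrite viol_dual; exact: orientation_viol.
- by move=> x; exact: Acard.
- move=> y; rewrite (eq_card (B := [set j | V (flip (compl y) j) && (j \in A (flip (compl y) j))])) //.
  by move=> j; rewrite !inE compl_flip.
- by rewrite total_influence_dual ltW.
Qed.

End UniformTest.

(** * Biased bits as monotone functions of fair bits *)

Lemma mono_in_le (I : finType) (g : pt I -> bool) (x y : pt I) :
  (forall j, mono_in j g) -> (forall i, x i -> y i) -> g x -> g y.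
Proof.
move=> mg xy gx.
have gz s : g (mix s y x).
  elim: s => [|i s IH].
    by rewrite (_ : mix _ _ _ = x) //; apply/ffunP => j; rewrite ffunE.
  have -> : mix (i :: s) y x = setc (mix s y x) i (y i).
    by apply/ffunP => j; rewrite !ffunE inE; case: eqP => [->|].
  set z := mix s y x in IH *; case yi : (y i).
    move: IH; rewrite -{1}(setc_id z i); case: (z i) => //; exact: mg.
  have zi : z i = false.
    by rewrite /z ffunE yi; case: ifP => // _; apply: contraFF yi => /xy.
  by rewrite -zi setc_id.
have := gz (enum I); rewrite (_ : mix _ _ _ = y) //.
by apply/ffunP => j; rewrite ffunE mem_enum.
Qed.

Lemma big_option_bool (R : realType) (F : option bool -> R) :
  \sum_o F o = F None + (F (Some true) + F (Some false)).
Proof.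
rewrite (bigD1 None) //= (bigD1 (Some true)) //= (bigD1 (Some false)) //=.
by rewrite big1 ?addr0 // => -[[]|].
Qed.

Section Bits.
Variable R : realType.

Definition behead_pt k (u : pt 'I_k.+1) : pt 'I_k := [ffun j => u (lift ord0 j)].
Definition cons_pt k (b : bool) (u : pt 'I_k) : pt 'I_k.+1 :=
  [ffun i => if unlift ord0 i is Some j then u j else b].

Lemma cons_pt0 k b (u : pt 'I_k) : cons_pt b u ord0 = b.
Proof. by rewrite ffunE unlift_none. Qed.

Lemma cons_ptK k b (u : pt 'I_k) : behead_pt (cons_pt b u) = u.
Proof. by apply/ffunP => j; rewrite !ffunE liftK. Qed.

Lemma behead_ptK k (u : pt 'I_k.+1) : cons_pt (u ord0) (behead_pt u) = u.
Proof. by apply/ffunP => i; rewrite ffunE; case: unliftP => [j|] ->; rewrite ?ffunE. Qed.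

Lemma avg_cons_pt k (F : pt 'I_k.+1 -> R) :
  avg F = (avg (fun u => F (cons_pt false u)) + avg (fun u => F (cons_pt true u))) / 2.
Proof.
rewrite /avg !card_ffun !card_bool !card_ord expnS natrM invfM.
rewrite (reindex (fun bu : bool * pt 'I_k => cons_pt bu.1 bu.2)) /=; last first.
  exists (fun u : pt 'I_k.+1 => (u ord0, behead_pt u)) => [[b u] _|u _] /=.
    by rewrite cons_pt0 cons_ptK.
  exact: behead_ptK.
rewrite -(pair_bigA _ (fun b u => F (cons_pt b u))) /= big_bool /=.
by move: (_^-1) => c; ring.
Qed.

(* A monotone function of [k] fair bits that is 1 with probability
   [bits_prob k p], the value of [p] rounded to [k] binary digits. *)
Fixpoint bits_fun k : R -> pt 'I_k -> bool :=
  match k with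
  | 0 => fun p _ => 2^-1 <= p
  | k'.+1 => fun p u =>
      if 2^-1 <= p then u ord0 || bits_fun (2 * p - 1) (behead_pt u)
      else u ord0 && bits_fun (2 * p) (behead_pt u)
  end.

Fixpoint bits_prob k (p : R) : R :=
  match k with
  | 0 => if 2^-1 <= p then 1 else 0
  | k'.+1 => if 2^-1 <= p then (1 + bits_prob k' (2 * p - 1)) / 2
             else bits_prob k' (2 * p) / 2
  end.

Lemma bits_prob_bounds k p : 0 <= bits_prob k p <= 1.
Proof.
elim: k p => [|k IH] p /=; first by case: ifP => _; lra.
by case: ifP => _; [have := IH (2 * p - 1) | have := IH (2 * p)]; lra.
Qed.

Lemma bits_prob_approx k p : 0 <= p <= 1 -> `|bits_prob k p - p| <= (2^-1) ^+ k.
Proof.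
elim: k p => [|k IH] p hp /=.
  by rewrite expr0; case: ifP => h; rewrite ler_norml; lra.
rewrite exprS; case: ifP => h.
  have /IH : 0 <= 2 * p - 1 <= 1 by lra.
  by rewrite !ler_norml => /andP [h1 h2]; lra.
have /IH : 0 <= 2 * p <= 1 by move/negbT: h; rewrite -ltNge; lra.
by rewrite !ler_norml => /andP [h1 h2]; lra.
Qed.

(* The uniform bits conditioned on [bits_fun = 0] and on [bits_fun = 1] can be
   coupled so that the former lie below the latter. *)
Lemma bits_coupling k p : exists (C : finType) (w : C -> R) (u0 u1 : C -> pt 'I_k),
  [/\ forall c, 0 <= w c, \sum_c w c = 1, forall c i, u0 c i -> u1 c i &
   forall h : pt 'I_k -> bool -> R,
     avg (fun u => h u (bits_fun p u)) =
     \sum_c w c * ((1 - bits_prob k p) * h (u0 c) false + bits_prob k p * h (u1 c) true)].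
Proof.
elim: k p => [|k IH] p.
  exists unit, (fun=> 1), (fun=> [ffun=> false]), (fun=> [ffun=> false]).
  have E (u : pt 'I_0) : u = [ffun=> false] by apply/ffunP => -[].
  split=> // [|h]; first by rewrite (big_pred1 tt) // => -[].
  rewrite (big_pred1 tt) => [|[]//].
  rewrite (eq_avg (G := fun=> h [ffun=> false] (2^-1 <= p))) => [|u]; last by rewrite (E u).
  by rewrite avg_pt_const /=; case: ifP => _; ring.
rewrite /=; case: ifP => hp.
  have [C [w [u0 [u1 [w0 w1 le01 H]]]]] := IH (2 * p - 1).
  have := bits_prob_bounds k (2 * p - 1); set P := bits_prob _ _ in H * => /andP [P0 P1].
  (* The extra coin tells how the value 1 arises: [Some b] is head 1 and tail value [b], [None] is
     head 0 and tail value 1. The weights are the probabilities of these cases given the value 1. *)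
  exists (C * option bool)%type, (fun c => w c.1 *
    (if c.2 is Some false then (1 - P) / (1 + P) else P / (1 + P))),
    (fun c => cons_pt false (u0 c.1)),
    (fun c => match c.2 with
      | None => cons_pt false (u1 c.1)
      | Some b => cons_pt true (if b then u1 c.1 else u0 c.1) end).
  split.
  - move=> [c [[]|]] /=; rewrite mulr_ge0 // divr_ge0 //; lra.
  - rewrite -(pair_bigA _ (fun c o => w c * (if o is Some false then _ else _))) /=.
    rewrite -[RHS]w1; apply: eq_bigr => c _; rewrite big_option_bool.
    by field; rewrite gt_eqF //; lra.
  - move=> [c [[]|]] i /=; rewrite !ffunE; case: unliftP => [j|] //= _; exact: le01.
  - move=> h; rewrite avg_cons_pt.
    under eq_avg do rewrite cons_pt0 cons_ptK /=.
    under [X in _ + X]eq_avg do rewrite cons_pt0 cons_ptK /=.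
    rewrite (H (fun u b => h (cons_pt false u) b)) (H (fun u b => h (cons_pt true u) true)).
    rewrite -big_split /= mulr_suml.
    rewrite -(pair_bigA _ (fun c o => w c * (if o is Some false then _ else _) *
      ((1 - (1 + P) / 2) * h (cons_pt false (u0 c)) false + (1 + P) / 2 *
       h (match o with None => cons_pt false (u1 c)
         | Some b => cons_pt true (if b then u1 c else u0 c) end) true))) /=.
    apply: eq_bigr => c _; rewrite big_option_bool /=.
    by field; rewrite gt_eqF //; lra.
have [C [w [u0 [u1 [w0 w1 le01 H]]]]] := IH (2 * p).
have := bits_prob_bounds k (2 * p); set P := bits_prob _ _ in H * => /andP [P0 P1].
(* Mirror image: the coin splits the value 0, with [Some b] for head 0 and tail value [b], and
   [None] for head 1 and tail value 0. *)
exists (C * option bool)%type, (fun c => w c.1 *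
  (if c.2 is Some true then P / (2 - P) else (1 - P) / (2 - P))),
  (fun c => match c.2 with
    | None => cons_pt true (u0 c.1)
    | Some b => cons_pt false (if b then u1 c.1 else u0 c.1) end),
  (fun c => cons_pt true (u1 c.1)).
split.
- move=> [c [[]|]] /=; rewrite mulr_ge0 // divr_ge0 //; lra.
- rewrite -(pair_bigA _ (fun c o => w c * (if o is Some true then _ else _))) /=.
  rewrite -[RHS]w1; apply: eq_bigr => c _; rewrite big_option_bool.
  by field; rewrite gt_eqF //; lra.
- move=> [c [[]|]] i /=; rewrite !ffunE; case: unliftP => [j|] //= _; exact: le01.
- move=> h; rewrite avg_cons_pt.
  under eq_avg do rewrite cons_pt0 cons_ptK /=.
  under [X in _ + X]eq_avg do rewrite cons_pt0 cons_ptK /=.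
  rewrite (H (fun u b => h (cons_pt true u) b)) (H (fun u b => h (cons_pt false u) false)).
  rewrite -big_split /= mulr_suml.
  rewrite -(pair_bigA _ (fun c o => w c * (if o is Some true then _ else _) *
    ((1 - P / 2) * h (match o with None => cons_pt true (u0 c)
       | Some b => cons_pt false (if b then u1 c else u0 c) end) false
     + P / 2 * h (cons_pt true (u1 c)) true))) /=.
  apply: eq_bigr => c _; rewrite big_option_bool /=.
  by field; rewrite gt_eqF //; lra.
Qed.

End Bits.

Lemma prod_pushforward (R : realType) (J C Y : finType) (w : C -> R) (t : C -> Y)
    (H : {ffun J -> Y} -> R) :
  \sum_(c : {ffun J -> C}) (\prod_j w (c j)) * H [ffun j => t (c j)] =
  \sum_(y : {ffun J -> Y}) (\prod_j \sum_(c | t c == y j) w c) * H y.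
Proof.
rewrite (partition_big (fun c : {ffun J -> C} => [ffun j => t (c j)] : {ffun J -> Y}) predT) //=.
apply: eq_bigr => y _; rewrite bigA_distr_big_dep mulr_suml.
apply: eq_big => [c|c /eqP <-] //.
apply/eqP/familyP => [<- j|h]; first by rewrite unfold_in ffunE.
by apply/ffunP => j; rewrite ffunE; have := h j; rewrite unfold_in => /eqP.
Qed.

(** * From the biased measure to fair bits *)

Section Reduction.
Variables (R : realType) (n k : nat) (p : R).

Definition bias_mass (x : cube n) : R :=
  \prod_i (if x i then bits_prob k p else 1 - bits_prob k p).

Definition sample_pt (u : pt ('I_n * 'I_k)%type) : cube n :=
  [ffun i => bits_fun p [ffun j => u (i, j)]].

(** Apply [bits_coupling] to each block independently. The coupled pairs [c] are drawn before the
    biased point [x], and for fixed [c] the map from [x] to the fair bits is monotone. *)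
Lemma coupling_pushforward : exists (C : finType) (w : C -> R) (u0 u1 : C -> pt 'I_k),
  [/\ forall c, 0 <= w c, \sum_c w c = 1, forall c i, u0 c i -> u1 c i &
  forall H : cube n -> pt ('I_n * 'I_k)%type -> R,
  avg (fun u => H (sample_pt u) u) =
  \sum_(c : {ffun 'I_n -> C}) (\prod_i w (c i)) *
    \sum_(x : cube n) bias_mass x *
      H x [ffun ij => (if x ij.1 then u1 (c ij.1) else u0 (c ij.1)) ij.2]].
Proof.
have [C [w [u0 [u1 [w0 w1 le01 E]]]]] := bits_coupling k p.
exists C, w, u0, u1; split=> // H.
pose P := bits_prob k p; pose D := pt 'I_k.
pose H' (y : {ffun 'I_n -> D * bool}) :=
  H [ffun i => (y i).2] [ffun ij => (y ij.1).1 ij.2].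
transitivity (\sum_(v : {ffun 'I_n -> D}) (\prod_(i < n) (#|{: D}|%:R^-1 : R)) *
    H' [ffun i => (v i, bits_fun p (v i))]).
  rewrite /avg (reindex (fun v : {ffun 'I_n -> D} =>
    [ffun ij => v ij.1 ij.2] : pt ('I_n * 'I_k)%type)) /=; last first.
    exists (fun u => [ffun i => [ffun j => u (i, j)]]) => [v _|u _].
      by apply/ffunP => i; apply/ffunP => j; rewrite !ffunE.
    by apply/ffunP => -[i j]; rewrite !ffunE.
  rewrite mulr_sumr; apply: eq_bigr => v _; congr (_ * _).
    rewrite prodr_const !card_ffun card_prod card_bool !card_ord mulnC expnM natrX.
    by rewrite exprVn.
  rewrite /H'; congr H; first apply/ffunP => i.
    rewrite !ffunE /=; congr (bits_fun p _).
    by apply/ffunP => j; rewrite !ffunE.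
  by apply/ffunP => -[i j]; rewrite !ffunE.
rewrite (prod_pushforward (fun=> #|{: D}|%:R^-1) (fun v => (v, bits_fun p v))).
transitivity (\sum_(c : {ffun 'I_n -> C * bool})
    (\prod_i (w (c i).1 * (if (c i).2 then P else 1 - P))) *
    H' [ffun i => (if (c i).2 then u1 (c i).1 else u0 (c i).1, (c i).2)]).
  rewrite (prod_pushforward (fun c => w c.1 * (if c.2 then P else 1 - P))
    (fun c => (if c.2 then u1 c.1 else u0 c.1, c.2))).
  apply: eq_bigr => y _; congr (_ * _); apply: eq_bigr => i _.
  have := E (fun u b => ((u, b) == y i)%:R); rewrite -/P /avg mulr_sumr => E'.
  rewrite big_mkcond /=; transitivity (\sum_(u : D) #|{: D}|%:R^-1 * ((u, bits_fun p u) == y i)%:R : R).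
    by apply: eq_bigr => u _; case: ifP => _; rewrite ?mulr1 ?mulr0.
  rewrite E' [RHS]big_mkcond /= -(pair_bigA _ (fun c b =>
    if (if b then u1 c else u0 c, b) == y i then w c * (if b then P else 1 - P) else 0)) /=.
  apply: eq_bigr => c _; rewrite big_bool /=.
  by case: eqP => _; case: eqP => _ /=; ring.
rewrite (reindex (fun cx : {ffun 'I_n -> C} * cube n => [ffun i => (cx.1 i, cx.2 i)])) /=; last first.
  exists (fun c => ([ffun i => (c i).1], [ffun i => (c i).2])) => [[c x] _|c _] /=.
    by congr (_, _); apply/ffunP => i; rewrite !ffunE.
  by apply/ffunP => i; rewrite !ffunE; case: (c i).
rewrite -(pair_bigA _ (fun (c : {ffun 'I_n -> C}) (x : cube n) =>
   (\prod_i (w ([ffun i => (c i, x i)] i).1 * (if ([ffun i => (c i, x i)] i).2 then P else 1 - P))) *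
    H' [ffun i => (if ([ffun i => (c i, x i)] i).2 then u1 ([ffun i => (c i, x i)] i).1 else u0 ([ffun i => (c i, x i)] i).1, ([ffun i => (c i, x i)] i).2)])) /=.
apply: eq_bigr => c _; rewrite mulr_sumr; apply: eq_bigr => x _.
rewrite mulrA; congr (_ * _).
  by rewrite -big_split /=; apply: eq_bigr => i _; rewrite ffunE.
rewrite /H'; congr H; apply/ffunP; [move=> i|case=> i j]; rewrite !ffunE //=.
Qed.

Lemma bias_mass_ge0 x : 0 <= bias_mass x.
Proof.
have /andP [P0 P1] := bits_prob_bounds k p.
by apply: prodr_ge0 => i _; case: (x i); lra.
Qed.

(** For each coupling outcome [c], pulling [g] back along the monotone map [lift_pt c] gives a
    monotone function on the cube. The distance on the fair bits is the average of the costs over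
    [c], so the cheapest [c] does. *)
Lemma monotone_reduction (f : cube n -> bool) (g : pt ('I_n * 'I_k)%type -> bool) :
  (forall j, mono_in j g) ->
  exists2 g' : boolfun n, monotone g' &
    \sum_x bias_mass x * (f x != g' x)%:R <= dist R (fun u => f (sample_pt u)) g.
Proof.
move=> mg; have [C [w [u0 [u1 [w0 w1 le01 E]]]]] := coupling_pushforward.
pose lift_pt (c : {ffun 'I_n -> C}) (x : cube n) : pt ('I_n * 'I_k)%type :=
  [ffun ij => (if x ij.1 then u1 (c ij.1) else u0 (c ij.1)) ij.2].
pose g' c : boolfun n := [ffun x => g (lift_pt c x)].
have mono_g' c : monotone (g' c).
  apply/forallP => x; apply/forallP => y; apply/implyP => /forallP xy.
  rewrite !ffunE; have h : g (lift_pt c x) -> g (lift_pt c y).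
    apply: mono_in_le => // -[i j]; rewrite !ffunE /=.
    by have := xy i; case: (x i); case: (y i) => // _; exact: le01.
  by move: h; case: (g _) => //= ->.
pose cost c := \sum_x bias_mass x * (f x != g' c x)%:R.
have total : dist R (fun u => f (sample_pt u)) g
    = \sum_(c : {ffun 'I_n -> C}) (\prod_i w (c i)) * cost c.
  rewrite /dist (E (fun x u => (f x != g u)%:R)); apply: eq_bigr => c _.
  by congr (_ * _); apply: eq_bigr => x _; rewrite ffunE.
have W1 : \sum_(c : {ffun 'I_n -> C}) \prod_i w (c i) = 1.
  by rewrite -(bigA_distr_bigA (fun=> w)) big1 // => i _; exact: w1.
have [c0 _|none] := pickP (@predT {ffun 'I_n -> C}); last first.
  by move: W1; rewrite big_pred0 // => /esym/eqP; rewrite oner_eq0.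
have [c _ cmin] := @arg_minP _ _ _ c0 predT cost isT.
exists (g' c) => //; rewrite -/(cost c) total.
apply: (@le_trans _ _ ((\sum_(c' : {ffun 'I_n -> C}) \prod_i w (c' i)) * cost c)).
  by rewrite W1 mul1r.
rewrite mulr_suml; apply: ler_sum => c' _; apply: ler_wpM2l; last exact: cmin.
by apply: prodr_ge0 => i _; exact: w0.
Qed.

End Reduction.

Lemma biasedE (R : realType) n (p : R) (x : cube n) :
  biased p x = \prod_i (if x i then p else 1 - p).
Proof.
rewrite /biased /hamming_weight cardsE (bigID (fun i => x i)) /=; congr (_ * _).
  by rewrite (eq_bigr (fun=> p)) ?prodr_const // => i ->.
rewrite (eq_bigr (fun=> 1 - p)) => [|i /negbTE -> //].
rewrite prodr_const; congr (_ ^+ _).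
have := cardC (fun i => x i); rewrite card_ord.
have -> : #|[predC (fun i => x i)]| = #|(fun i => ~~ x i)| by apply: eq_card.
by set a := #|_|; set b := #|_| => h; apply: (@addnI a); rewrite h subnKC // -h leq_addr.
Qed.

(** Rounding [p] costs each coordinate a factor of at most 1 + 1 / (2 n), and [n] such factors
    multiply to at most 2. *)
Lemma biased_le (R : realType) n k (p : R) (x : cube n) : (0 < n)%N -> 0 <= p <= 1 ->
  4 * n%:R * (2^-1) ^+ k <= p -> 4 * n%:R * (2^-1) ^+ k <= 1 - p ->
  biased p x <= 2 * bias_mass k p x.
Proof.
move=> n0 hp hk1 hk2; have := bits_prob_approx k hp.
rewrite ler_norml; set P := bits_prob k p; set e := _ ^+ k in hk1 hk2 * => /andP [P1 P2].
have n1 : 1 <= n%:R :> R by rewrite ler1n.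
have e0 : 0 <= e by rewrite exprn_ge0 // invr_ge0.
pose delta : R := (2 * n%:R)^-1.
have d0 : 0 < delta by rewrite invr_gt0; lra.
have dn : delta * n%:R = 2^-1 by rewrite /delta; field; rewrite gt_eqF //; lra.
have d1 : delta <= 1 by nra.
have key (a b : R) : 4 * n%:R * e <= a -> a - e <= b -> a <= (1 + delta) * b.
  move=> h1 h2.
  have h3 : 2 * e <= delta * a.
    have := ler_wpM2l (ltW d0) h1.
    have -> : delta * (4 * n%:R * e) = 4 * (delta * n%:R) * e by ring.
    by rewrite dn; lra.
  have : (1 + delta) * (a - e) <= (1 + delta) * b by rewrite ler_wpM2l //; lra.
  nra.
rewrite biasedE; apply: (@le_trans _ _ (\prod_(i < n) ((1 + delta) * (if x i then P else 1 - P)))).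
  apply: ler_prod => i _; case: (x i); apply/andP; split; try lra; apply: key; lra.
rewrite big_split /= prodr_const card_ord -/(bias_mass k p x).
apply: ler_wpM2r; first exact: bias_mass_ge0.
by apply: exprD1_le2; [exact: ltW | rewrite -mulrA [n%:R * _]mulrC dn; lra].
Qed.

Lemma monotone_false n : monotone ([ffun=> false] : boolfun n).
Proof.
by apply/forallP => x; apply/forallP => y; apply/implyP => _; rewrite !ffunE.
Qed.

Lemma dist_monotone_le (R : realType) n (mu : cube n -> R) (f g : boolfun n) :
  monotone g -> dist_monotone mu f <= disagreement mu f g.
Proof.
move=> mg; rewrite /dist_monotone.
by case: arg_minP => [|h _ hmin]; [exact: monotone_false|exact: hmin].
Qed.

Lemma far_reduction (R : realType) n k (p eps : R) (f : boolfun n) : (0 < n)%N ->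
  0 <= p <= 1 -> 4 * n%:R * (2^-1) ^+ k <= p -> 4 * n%:R * (2^-1) ^+ k <= 1 - p ->
  far_from_monotone (biased p) eps f ->
  forall g : pt ('I_n * 'I_k)%type -> bool, (forall j, mono_in j g) ->
    eps / 2 <= dist R (fun u => f (sample_pt p u)) g.
Proof.
move=> n0 hp h1 h2 far g mg.
have [g' mg' hg'] := monotone_reduction p f mg.
apply: le_trans hg'; rewrite ler_pdivrMr // mulrC mulr_sumr.
apply: (@le_trans _ _ (disagreement (biased p) f g')).
  exact: le_trans far (dist_monotone_le _ _ mg').
rewrite /disagreement big_mkcond; apply: ler_sum => x _.
case: (f x != g' x); rewrite ?mulr0 // mulr1; exact: biased_le.
Qed.

(** * The algorithm *)

Lemma all_zip_halves (T U : Type) (a b : T -> U) (f : U -> bool) (e : seq T) (M : nat) :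
  size e = M ->
  all (fun bc => bc.1 ==> bc.2)
    (zip (take M [seq f x | x <- map a e ++ map b e])
         (drop M [seq f x | x <- map a e ++ map b e]))
  = all (fun i => f (a i) ==> f (b i)) e.
Proof.
move=> <-; rewrite map_cat take_size_cat ?size_map // drop_size_cat ?size_map //.
by rewrite -!map_comp zip_map all_map.
Qed.

Section Repetition.
Variables (R : realType) (n : nat).

Record pair_test := PairTest {
  pair_coins : finType;
  pair_mass : pair_coins -> R;
  pair_mass_ge0 : forall c, 0 <= pair_mass c;
  pair_mass_sum1 : \sum_c pair_mass c = 1;
  pair_low : pair_coins -> cube n;
  pair_high : pair_coins -> cube n;
  pair_le : forall c, cube_le (pair_low c) (pair_high c)
}.

Variable P : pair_test.

Definition catches (f : boolfun n) (c : pair_coins P) := f (pair_low c) && ~~ f (pair_high c).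

Definition catch_prob (f : boolfun n) : R := \sum_(c | catches f c) pair_mass c.

Section Algorithm.
Variable M : nat.

Let rep_mass (s : {ffun 'I_M -> pair_coins P}) : R := \prod_i pair_mass (s i).

Lemma rep_mass_ge0 s : 0 <= rep_mass s.
Proof. by apply: prodr_ge0 => i _; exact: pair_mass_ge0. Qed.

Lemma rep_mass_sum1 : \sum_s rep_mass s = 1.
Proof.
rewrite /rep_mass -(bigA_distr_bigA (fun=> @pair_mass P)).
by rewrite big1 // => i _; exact: pair_mass_sum1.
Qed.

(** All lower points are queried before all upper points, so the verdict splits the answers at [M]
    and pairs them again; it rejects only on a drop it has seen, which gives one-sided error. *)
Definition repeat_test : nonadaptive_algorithm R n :=
  @NonadaptiveAlgorithm R n {ffun 'I_M -> pair_coins P} rep_mass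
    rep_mass_ge0 rep_mass_sum1
    (fun s => [seq pair_low (s i) | i <- enum 'I_M]
              ++ [seq pair_high (s i) | i <- enum 'I_M])
    (fun _ a => all (fun bc => bc.1 ==> bc.2) (zip (take M a) (drop M a))).

Lemma repeat_test_queries : (query_complexity repeat_test <= 2 * M)%N.
Proof.
apply/bigmax_leqP => s _ /=.
by rewrite size_cat !size_map -enumT size_enum_ord addnn mul2n.
Qed.

Lemma repeat_test_accepts f s :
  @accepts _ _ repeat_test f s = [forall i, ~~ catches f (s i)].
Proof.
have -> : @accepts _ _ repeat_test f s
    = all (fun i => f (pair_low (s i)) ==> f (pair_high (s i))) (enum 'I_M).
  by apply: all_zip_halves; rewrite size_enum_ord.
apply/allP/forallP => [h i|h i _]; last first.
  by have := h i; rewrite /catches negb_and negbK implybE.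
by have := h i (mem_enum _ i); rewrite /catches negb_and negbK implybE.
Qed.

Lemma repeat_test_prob f : prob_accept repeat_test f = (1 - catch_prob f) ^+ M.
Proof.
have -> : 1 - catch_prob f = \sum_(c | ~~ catches f c) pair_mass c.
  by rewrite -(@pair_mass_sum1 P) (bigID (catches f)) /= /catch_prob addrAC subrr add0r.
rewrite -[M in RHS]card_ord -prodr_const bigA_distr_big.
apply: eq_bigl => s; rewrite repeat_test_accepts.
by apply/forallP/ffun_onP.
Qed.

Lemma repeat_test_complete f : monotone f -> prob_accept repeat_test f = 1.
Proof.
move=> /forallP mf; rewrite repeat_test_prob /catch_prob big_pred0 ?subr0 ?expr1n // => c.
apply/negP => /andP [f0 f1]; have /forallP /(_ (pair_high c)) := mf (pair_low c).
by rewrite pair_le f0 (negbTE f1).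
Qed.

(** A polynomial substitute for the exponential bound: once M r >= 2, acceptance has probability at
    most 1/3. *)
Lemma expr1B_le (r : R) : 0 <= r <= 1 -> (1 - r) ^+ M * (1 + M%:R * r) <= 1.
Proof.
move=> /andP [r0 r1]; elim: M => [|m IH]; first by rewrite expr0 mul0r addr0 mul1r.
apply: le_trans IH; rewrite exprSr -mulrA; apply: ler_wpM2l.
  by rewrite exprn_ge0 // subr_ge0.
rewrite -natr1; have : 0 <= m%:R :> R by [].
nra.
Qed.

Lemma repeat_test_sound (rho : R) f : 0 < rho -> 2 <= M%:R * rho ->
  rho <= catch_prob f -> 2 / 3 <= prob_reject repeat_test f.
Proof.
move=> rho0 hM hc.
have -> : prob_reject repeat_test f = 1 - prob_accept repeat_test f.
  rewrite -rep_mass_sum1 (bigID (fun s => @accepts _ _ repeat_test f s)) /=.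
  by rewrite /prob_accept addrAC subrr add0r.
rewrite repeat_test_prob; set r := catch_prob f in hc *.
have r1 : r <= 1.
  rewrite -(@pair_mass_sum1 P) [leRHS](bigID (catches f)) /= lerDl.
  by apply: sumr_ge0 => c _; exact: pair_mass_ge0.
have := @expr1B_le r; have : 0 <= (1 - r) ^+ M by rewrite exprn_ge0 // subr_ge0.
move: (_ ^+ M) => x x0 h.
have {}h : x * (1 + M%:R * r) <= 1 by apply: h; lra.
have : 2 <= M%:R * r by apply: le_trans hM _; rewrite ler_wpM2l.
nra.
Qed.

End Algorithm.

End Repetition.

Lemma sum_pair (R : realType) (A B : finType) (F : A * B -> R) :
  \sum_p F p = \sum_a \sum_b F (a, b).
Proof. by rewrite pair_bigA; apply: eq_bigr => -[]. Qed.

(** * The mixture of all pair tests *)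

Section UniformPairs.
Variables (R : realType) (I : finType) (l : nat).
Local Notation pt := (pt I).
Hypotheses (I0 : (0 < #|I|)%N) (l0 : (0 < l)%N).

(** The right scale and side depend on [f], so they are drawn at random: [None] is the edge test,
    [Some (t, b)] the jump test at scale [t] for [f] or its dual. *)
Definition tag := option ('I_(7 * l) * bool).

Definition tag_scale (a : tag) : R := if a is Some (t, _) then scale R I l t else 0.

Definition test_coin := (tag * (pt * (pt * I)))%type.

Definition test_mass (c : test_coin) : R :=
  #|{: tag}|%:R^-1 * (#|{: pt}|%:R^-1 * (mask_mass (tag_scale c.1) c.2.2.1 * #|I|%:R^-1)).

(** In the dual test, a drop of [dual f] from [x] up to [joinp x m] is a drop of [f] from the
    complement of [joinp x m] up to that of [x]. *)
Definition test_low (c : test_coin) : pt :=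
  let: (a, (x, (m, i))) := c in
  match a with
  | Some (_, true) => x
  | Some (_, false) => compl (joinp x m)
  | None => setc x i false
  end.

Definition test_high (c : test_coin) : pt :=
  let: (a, (x, (m, i))) := c in
  match a with
  | Some (_, true) => joinp x m
  | Some (_, false) => compl x
  | None => setc x i true
  end.

Lemma scale_bounds t : 0 <= scale R I l t <= 1.
Proof.
rewrite /scale; set N := Num.sqrt _; have N1 : 1 <= N by rewrite -sqrtr1 ler_wsqrtr // ler1n.
have l1 : 1 <= l%:R :> R by rewrite ler1n.
have h0 : 0 <= (2^-1) ^+ t :> R by rewrite exprn_ge0 // invr_ge0.
have h1 : (2^-1) ^+ t <= 1 :> R by rewrite exprn_ile1 ?invr_ge0 // invf_le1 // ler1n.
have hN : 1 <= l%:R * N by nra.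
rewrite divr_ge0 //=; last by rewrite -mulrA; lra.
by rewrite ler_pdivrMr -?mulrA; lra.
Qed.

Lemma tag_scale_bounds a : 0 <= tag_scale a <= 1.
Proof. by case: a => [[t b]|] /=; rewrite ?scale_bounds // lexx ler01. Qed.

Lemma test_mass_ge0 c : 0 <= test_mass c.
Proof.
have /andP [h0 h1] := tag_scale_bounds c.1.
by rewrite !mulr_ge0 ?invr_ge0 ?mask_mass_ge0.
Qed.

Lemma test_sum (F : test_coin -> R) :
  \sum_c test_mass c * F c =
  avg (fun a : tag => avg (fun x : pt => mask_avg (tag_scale a) (fun m =>
    avg (fun i : I => F (a, (x, (m, i))))))).
Proof.
rewrite sum_pair [RHS]/avg mulr_sumr.
apply: eq_bigr => a _.
rewrite sum_pair [in RHS]/avg !mulr_sumr; apply: eq_bigr => x _.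
rewrite sum_pair [in RHS]/mask_avg !mulr_sumr; apply: eq_bigr => m _.
rewrite !mulr_sumr; apply: eq_bigr => i _.
by rewrite /test_mass /= !mulrA.
Qed.

Lemma card_tag : #|{: tag}| = (14 * l).+1.
Proof. by rewrite card_option card_prod card_ord card_bool mulnAC. Qed.

Lemma test_mass_sum1 : \sum_c test_mass c = 1.
Proof.
transitivity (\sum_c test_mass c * 1); first by apply: eq_bigr => c _; rewrite mulr1.
rewrite (test_sum (fun=> 1)) (eq_avg (G := fun=> 1)); first by rewrite avg_const // card_tag.
move=> a; rewrite -[RHS](avg_pt_const I); apply: eq_avg => x.
rewrite (eq_mask_avg _ (G := fun=> 1)) ?mask_avg_const // => m.
exact: avg_const.
Qed.

Lemma test_low_high c j : test_low c j -> test_high c j.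
Proof.
case: c => [[[t []]|] [x [m i]]] /=; rewrite !ffunE.
- by move=> ->.
- by rewrite negb_or => /andP [].
- by case: eqP.
Qed.

Definition uniform_catch (f : pt -> bool) : R :=
  \sum_(c | f (test_low c) && ~~ f (test_high c)) test_mass c.

(** One successful tag is enough: drawing it costs the number of tags, [(14 * l).+1]. *)
Lemma uniform_catch_ge f (rho : R) :
  rho <= edge_success R f \/
  (exists t b, (t < 7 * l)%N /\ rho <= up_success (scale R I l t) (if b then f else dual f)) ->
  rho / (14 * l).+1%:R <= uniform_catch f.
Proof.
move=> h.
pose S a := avg (fun x : pt => mask_avg (tag_scale a) (fun m => avg (fun i : I =>
  (f (test_low (a, (x, (m, i)))) && ~~ f (test_high (a, (x, (m, i)))))%:R))) : R.
have -> : uniform_catch f = avg S.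
  rewrite /uniform_catch big_mkcond /= -(test_sum (fun c => (f (test_low c) && ~~ f (test_high c))%:R)).
  by apply: eq_bigr => c _; case: ifP => _; rewrite ?mulr1 ?mulr0.
have S0 a : 0 <= S a.
  have /andP [h0 h1] := tag_scale_bounds a.
  by apply: avg_ge0 => x; apply: mask_avg_ge0 => // m; apply: avg_ge0 => i.
have [a ha] : exists a, rho <= S a.
  case: h => [h|[t [b [tl h]]]].
    exists None; apply: le_trans h _; rewrite /edge_success /neg_influence.
    rewrite avg_sum mulr_sumr /S /=.
    rewrite le_eqVlt; apply/orP; left; apply/eqP; rewrite -mulr_sumr -avg_sum -avgZ.
    apply: eq_avg => x; rewrite mask_avg_const; congr (_ * _).
  exists (Some (Ordinal tl, b)); apply: le_trans h _.
  rewrite le_eqVlt; apply/orP; left; apply/eqP; apply: eq_avg => x.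
  apply: eq_mask_avg => m; case: b => /=.
    by rewrite avg_const.
  by rewrite avg_const // /dual negbK andbC.
rewrite /avg card_tag mulrC ler_wpM2l ?invr_ge0 //.
by rewrite (bigD1 a) //= ler_wpDr // sumr_ge0.
Qed.

End UniformPairs.

Lemma bits_fun_mono (R : realType) k (p : R) (u v : pt 'I_k) :
  (forall j, u j -> v j) -> bits_fun p u -> bits_fun p v.
Proof.
elim: k p u v => //= k IH p u v uv.
have uv' j : behead_pt u j -> behead_pt v j by rewrite !ffunE; exact: uv.
case: ifP => _.
  by move=> /orP [/uv ->//|/(IH _ _ _ uv') ->]; rewrite orbT.
by move=> /andP [/uv -> /(IH _ _ _ uv') ->].
Qed.

Section BiasedTest.
Variables (R : realType) (p : R) (n k l : nat).
Let I : finType := ('I_n * 'I_k)%type.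
Hypotheses (I0 : (0 < #|I|)%N) (l0 : (0 < l)%N).

Lemma sample_pt_le (c : test_coin I l) :
  cube_le (sample_pt p (test_low c)) (sample_pt p (test_high c)).
Proof.
apply/forallP => i; rewrite !ffunE.
suff : bits_fun p [ffun j => test_low c (i, j)] ->
       bits_fun p [ffun j => test_high c (i, j)].
  by case: (bits_fun _ _) => // ->.
by apply: bits_fun_mono => j; rewrite !ffunE; exact: test_low_high.
Qed.

Definition biased_test : pair_test R n :=
  @PairTest R n (test_coin I l) (@test_mass R I l) (test_mass_ge0 R I0 l0)
    (test_mass_sum1 R l I0) (fun c => sample_pt p (test_low c))
    (fun c => sample_pt p (test_high c)) sample_pt_le.

Lemma biased_test_catch f :
  catch_prob biased_test f = uniform_catch R l (fun u : pt I => f (sample_pt p u)).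
Proof. by []. Qed.

End BiasedTest.

(** * Logarithm estimates, trivial cases and choice of parameters *)

Section Logarithms.
Variable R : realType.

Lemma ln2_ge : 2^-1 <= ln 2 :> R.
Proof.
rewrite -ler_expR lnK ?posrE // -[leLHS]invrK -expRN.
have h := expR_ge1Dx (- 2^-1 : R).
have : 2^-1 <= expR (- 2^-1) :> R by lra.
by rewrite -[leRHS]invrK lef_pV2 ?posrE ?invr_gt0 ?expR_gt0.
Qed.

Lemma two_exp_truncn (L : R) : 0 <= L -> expR L <= 2 ^+ (Num.truncn (2 * L)).+1.
Proof.
move=> L0; set a := (Num.truncn _).+1; have aL : 2 * L < a%:R := truncnS_gt _.
rewrite -[2]lnK ?posrE // -expRM_natl ler_expR.
have := ln2_ge; have : 0 <= a%:R :> R by []; nra.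
Qed.

Lemma small_half_pow (m : R) : 0 < m -> exists k, 4 * (2^-1) ^+ k <= m.
Proof.
move=> m0; pose k := (Num.truncn (4 / m)).+1; exists k.
have h : 4 / m < k%:R := truncnS_gt _.
have hk : k%:R <= 2 ^+ k :> R by rewrite -natrX ler_nat ltnW // ltn_expl.
rewrite exprVn ler_pdivrMr ?exprn_gt0 //.
by move: h; rewrite ltr_pdivrMr //; nra.
Qed.

End Logarithms.

Section TrivialTest.
Variables (R : realType) (n : nat).

Lemma unit_mass_sum1 : \sum_(u : unit) 1 = 1 :> R.
Proof. by rewrite (big_pred1 tt) // => -[]. Qed.

Definition accept_all : nonadaptive_algorithm R n :=
  @NonadaptiveAlgorithm R n unit (fun=> 1) (fun=> ler01) unit_mass_sum1
    (fun=> [::]) (fun _ _ => true).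

Lemma accept_all_queries : query_complexity accept_all = 0%N.
Proof. by apply/eqP; rewrite -leqn0; apply/bigmax_leqP. Qed.

Lemma accept_all_tester (mu : cube n -> R) (eps : R) :
  (forall f, ~ far_from_monotone mu eps f) -> monotonicity_tester mu eps accept_all.
Proof.
move=> nofar; split=> [f _|f /nofar //].
by rewrite /prob_accept /= (big_pred1 tt) // => -[].
Qed.

End TrivialTest.

Lemma biased_ge0 (R : realType) n (p : R) (x : cube n) : 0 <= p <= 1 -> 0 <= biased p x.
Proof. by move=> hp; rewrite mulr_ge0 // exprn_ge0; lra. Qed.

Lemma biased_sum1 (R : realType) n (p : R) : \sum_(x : cube n) biased p x = 1.
Proof.
rewrite (eq_bigr _ (fun x _ => biasedE p x)).
rewrite -(bigA_distr_bigA (fun=> fun b : bool => if b then p else 1 - p)).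
by rewrite big1 // => i _; rewrite big_bool /=; ring.
Qed.

Lemma dist_monotone_le1 (R : realType) n (p : R) (f : boolfun n) :
  0 <= p <= 1 -> dist_monotone (biased p) f <= 1.
Proof.
move=> hp; apply: le_trans (dist_monotone_le _ _ (monotone_false n)) _.
rewrite -(biased_sum1 n p) /disagreement big_mkcond; apply: ler_sum => x _.
by case: ifP => // _; exact: biased_ge0.
Qed.

Lemma dist_monotone_dim0 (R : realType) (mu : cube 0 -> R) (f : boolfun 0) :
  dist_monotone mu f <= 0.
Proof.
apply: le_trans (dist_monotone_le _ _ (g := f) _) _.
  apply/forallP => x; apply/forallP => y; apply/implyP => _.
  by rewrite (_ : x = y) //; apply/ffunP => -[].
by rewrite /disagreement big_pred0 // => x; rewrite eqxx.
Qed.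

(* [a] stands for the constant in the rejection probability of one pair test. *)
Lemma query_bound (R : realType) (a rho e s N k l : R) :
  0 < a -> 0 < e <= 1 -> 1 <= s -> 0 < N -> N <= s * k -> 0 <= k <= l -> 1 <= l ->
  rho = (e / 2) ^+ 2 / (a * l ^+ 5 * N) / (14 * l + 1) ->
  2 * (2 / rho + 1) <= (240 * a + 2) * (s / e ^+ 2) * l ^+ 7.
Proof.
move=> a0 /andP [e0 e1] s1 N0 Nk /andP [k0 kl] l1 ->.
have -> : 2 * (2 / ((e / 2) ^+ 2 / (a * l ^+ 5 * N) / (14 * l + 1)) + 1)
   = 16 * a * (e ^+ 2)^-1 * (l ^+ 5 * (N * (14 * l + 1))) + 2.
  by field; rewrite !gt_eqF //; lra.
have Nl : N <= s * l by apply: le_trans Nk _; rewrite ler_wpM2l //; lra.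
have l5 : 0 <= l ^+ 5 by rewrite exprn_ge0 //; lra.
have l7 : 1 <= l ^+ 7 by rewrite exprn_ege1.
have ei : 1 <= (e ^+ 2)^-1 by rewrite invf_ge1 ?exprn_gt0 // exprn_ile1 // ltW.
have h : N * (14 * l + 1) <= s * l * (15 * l).
  by apply: ler_pM => //; lra.
have h2 : l ^+ 5 * (N * (14 * l + 1)) <= 15 * (s * l ^+ 7).
  apply: le_trans (ler_wpM2l l5 h) _.
  by rewrite le_eqVlt; apply/orP; left; apply/eqP; ring.
have h3 : 16 * a * (e ^+ 2)^-1 * (l ^+ 5 * (N * (14 * l + 1)))
    <= 16 * a * (e ^+ 2)^-1 * (15 * (s * l ^+ 7)).
  by rewrite ler_wpM2l // !mulr_ge0 //; lra.
have h4 : 1 <= s * (e ^+ 2)^-1 * l ^+ 7.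
  by rewrite !mulr_ege1.
apply: le_trans (lerD h3 (lexx _)) _.
set z := s * _ * _ in h4.
have -> : (240 * a + 2) * (s / e ^+ 2) * l ^+ 7 = (240 * a + 2) * z by rewrite /z; ring.
have -> : 16 * a * (e ^+ 2)^-1 * (15 * (s * l ^+ 7)) = 240 * a * z by rewrite /z; ring.
lra.
Qed.

Lemma choose_bits (R : realType) (kp n : nat) (eps L : R) :
  (0 < n)%N -> 0 < eps -> 1 <= L -> expR L = (n%:R + 2) * (eps^-1 + 2) ->
  exists k l : nat, [/\ (0 < k)%N, n%:R * (2^-1) ^+ k <= (2^-1) ^+ kp :> R,
    8 * (n%:R * k%:R) / eps <= 2 ^+ l, (k <= l)%N & l%:R <= (9 + kp%:R) * L].
Proof.
move=> n0 e0 L1 LX.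
have [l1 [l1_gt0 l1L X_le]] : exists l1 : nat,
    [/\ (0 < l1)%N, l1%:R <= 2 * L + 1 & (n%:R + 2) * (eps^-1 + 2) <= 2 ^+ l1].
  exists (Num.truncn (2 * L)).+1; split=> //.
    by rewrite -natr1 lerD2r truncn_le; lra.
  by rewrite -LX two_exp_truncn //; lra.
have i0 : 0 < eps^-1 by rewrite invr_gt0.
have n1 : 0 <= n%:R :> R by [].
have ni0 : 0 <= n%:R * eps^-1 by rewrite mulr_ge0 // ltW.
have n_le : n%:R <= 2 ^+ l1 :> R.
  by apply: le_trans X_le; rewrite mulrDr !mulrDl; lra.
have ne_le : n%:R / eps <= 2 ^+ l1.
  by apply: le_trans X_le; rewrite mulrDr !mulrDl; lra.
(* [kp] is a fixed precision and 2^l1 bounds both n and n / eps; [l] adds up the exponents for the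
   factor 8, for [k <= 2 ^ k] and for n / eps. *)
exists (kp + l1)%N, (3 + (kp + l1) + l1)%N; split.
- by rewrite addn_gt0 l1_gt0 orbT.
- rewrite exprD mulrCA ler_piMr ?exprn_ge0 ?invr_ge0 //.
  by rewrite exprVn ler_pdivrMr ?exprn_gt0 // mul1r.
- move: (kp + l1)%N => k; rewrite exprD (exprD _ 3 k).
  have k_le : k%:R <= 2 ^+ k :> R by rewrite -natrX ler_nat ltnW // ltn_expl.
  have -> : 8 * (n%:R * k%:R) / eps = 2 ^+ 3 * k%:R * (n%:R / eps).
    by field; rewrite gt_eqF.
  apply: ler_pM => //; first by rewrite mulr_ge0 // exprn_ge0.
  by rewrite ler_wpM2l // exprn_ge0.
- by rewrite addnAC leq_addl.
- rewrite !natrD; have : 0 <= kp%:R :> R by [].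
  move: (kp%:R) => z z0; have := ler_wpM2l z0 L1; lra.
Qed.

(** The seventh power collects [l ^ 5] from the success probability, one [l] from the number of tags
    and one from the [k] fair bits per coordinate, as sqrt (n k) <= k sqrt n. *)
Lemma biased_tester (R : realType) (p : R) : 0 < p -> p < 1 ->
  exists C : R, 0 <= C /\ forall (n : nat) (eps : R), 0 < eps ->
    exists2 T : nonadaptive_algorithm R n,
      (query_complexity T)%:R <= C * (Num.sqrt n%:R / eps ^+ 2)
          * (ln (n%:R + 2) + ln (eps^-1 + 2)) ^+ 7 &
      monotonicity_tester (biased p) eps T.
Proof.
move=> p0 p1; have hp : 0 <= p <= 1 by lra.
have [kp0 hk0] := small_half_pow p0.
have [kp1 hk1] : exists k, 4 * (2^-1) ^+ k <= 1 - p by apply: small_half_pow; lra.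
pose kp := (kp0 + kp1)%N.
have half_le (i j : nat) : (i <= j)%N -> (2^-1) ^+ j <= (2^-1) ^+ i :> R.
  by move=> ij; apply: ler_wiXn2l => //; rewrite ?invr_ge0 // invf_le1 // ler1n.
have hkp0 : 4 * (2^-1) ^+ kp <= p.
  by apply: le_trans hk0; rewrite ler_pM2l // half_le // leq_addr.
have hkp1 : 4 * (2^-1) ^+ kp <= 1 - p.
  by apply: le_trans hk1; rewrite ler_pM2l // half_le // leq_addl.
pose a : R := 512 * 640; have a0 : 0 < a by rewrite /a mulr_gt0.
pose C : R := (240 * a + 2) * (9 + kp%:R) ^+ 7.
have C0 : 0 <= C by rewrite mulr_ge0 ?exprn_ge0 // addr_ge0 // mulr_ge0 // ltW.
exists C; split=> // n eps e0.
set L := ln _ + ln _.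
have i0 : 0 < eps^-1 by rewrite invr_gt0.
have L1 : 1 <= L.
  have ln_ge (y : R) : 0 <= y -> 2^-1 <= ln (y + 2).
    move=> y0; apply: le_trans (ln2_ge R) _; rewrite ler_ln ?posrE //; lra.
  have := ln_ge n%:R (ler0n R n); have := ln_ge _ (ltW i0); rewrite /L; lra.
have trivial_ok : (forall f : boolfun n, ~ far_from_monotone (biased p) eps f) ->
    exists2 T : nonadaptive_algorithm R n,
      (query_complexity T)%:R <= C * (Num.sqrt n%:R / eps ^+ 2) * L ^+ 7 &
      monotonicity_tester (biased p) eps T.
  move=> nofar; exists (accept_all R n); last exact: (accept_all_tester nofar).
  rewrite accept_all_queries mulr_ge0 ?exprn_ge0 //; last by lra.
  by rewrite mulr_ge0 // divr_ge0 ?sqrtr_ge0 // exprn_ge0 // ltW.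
(* In dimension 0 the query budget is 0, but every function is monotone; for [eps > 1] no function
   is far. In both cases accepting without queries is correct. *)
have [n0|n0] := posnP n.
  apply: trivial_ok => f; rewrite /far_from_monotone; subst n.
  by have := dist_monotone_dim0 (biased p) f => h /le_trans /(_ h); lra.
have [e1|e1] := ltP 1 eps.
  apply: trivial_ok => f; rewrite /far_from_monotone.
  by have := dist_monotone_le1 f hp => h /le_trans /(_ h); lra.
clear trivial_ok.
have LX : expR L = (n%:R + 2) * (eps^-1 + 2).
  have n2 : 0 < n%:R + 2 :> R by rewrite ltr_wpDl.
  by rewrite /L expRD !lnK ?posrE // addr_gt0.
have [k [l [k0 hk l_large kl lL]]] := choose_bits kp n0 e0 L1 LX.
have n1 : 1 <= n%:R :> R by rewrite ler1n.
have {}hk (q : R) : 4 * (2^-1) ^+ kp <= q -> 4 * n%:R * (2^-1) ^+ k <= q.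
  by apply: le_trans; rewrite -mulrA ler_pM2l.
pose I : finType := ('I_n * 'I_k)%type.
have cardI : #|I| = (n * k)%N by rewrite card_prod !card_ord.
have I0 : (0 < #|I|)%N by rewrite cardI muln_gt0 n0.
have l0 : (0 < l)%N by exact: leq_trans kl.
have {}l_large : 4 * #|I|%:R / (eps / 2) <= 2 ^+ l.
  by rewrite cardI natrM; apply: le_trans l_large; rewrite invfM invrK; lra.
have eps20 : 0 < eps / 2 by rewrite divr_gt0.
have eps21 : eps / 2 <= 1 by rewrite ler_pdivrMr // mul1r (le_trans e1) // ler1n.
pose N : R := Num.sqrt #|I|%:R.
have N1 : 1 <= N by rewrite -sqrtr1 ler_wsqrtr // ler1n.
have lR1 : 1 <= l%:R :> R by rewrite ler1n.
pose rho0 : R := (eps / 2) ^+ 2 / (a * l%:R ^+ 5 * N).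
have rho0_gt0 : 0 < rho0.
  rewrite divr_gt0 ?exprn_gt0 // mulr_gt0 ?(lt_le_trans ltr01 N1) //.
  by rewrite mulr_gt0 ?exprn_gt0 // ltr0n.
pose rho : R := rho0 / (14 * l%:R + 1).
have rho_gt0 : 0 < rho by rewrite divr_gt0 //; lra.
pose M := (Num.truncn (2 / rho)).+1.
have M_gt : 2 / rho < M%:R := truncnS_gt _.
have M_le : M%:R <= 2 / rho + 1.
  by rewrite /M -natr1 lerD2r truncn_le divr_ge0 // ltW.
exists (repeat_test (biased_test p I0 l0) M).
  apply: (@le_trans _ _ (2 * (2 / rho + 1))).
    apply: (@le_trans _ _ (2 * M)%:R); first by rewrite ler_nat repeat_test_queries.
    by rewrite natrM ler_pM2l.
  apply: le_trans (query_bound (s := Num.sqrt n%:R) (e := eps) (N := N) (k := k%:R)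
     (l := l%:R) a0 _ _ _ _ _ _ erefl) _ => //.
  - by rewrite e0 e1.
  - by rewrite -[leLHS]sqrtr1 ler_wsqrtr.
  - exact: lt_le_trans ltr01 N1.
  - rewrite /N cardI natrM sqrtrM // ler_wpM2l ?sqrtr_ge0 //.
    have k1 : 1 <= k%:R :> R by rewrite ler1n.
    rewrite -[leRHS]ger0_norm // -sqrtr_sqr ler_wsqrtr //; nra.
  - by rewrite ler0n ler_nat.
  have lL7 : l%:R ^+ 7 <= (9 + kp%:R) ^+ 7 * L ^+ 7.
    by rewrite -exprMn lerXn2r ?nnegrE //; lra.
  have -> : C * (Num.sqrt n%:R / eps ^+ 2) * L ^+ 7
      = (240 * a + 2) * (Num.sqrt n%:R / eps ^+ 2) * ((9 + kp%:R) ^+ 7 * L ^+ 7).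
    by rewrite /C; ring.
  apply: ler_wpM2l => //; rewrite mulr_ge0 //; first by rewrite addr_ge0 // mulr_ge0 // ltW.
  by rewrite divr_ge0 ?sqrtr_ge0 // exprn_ge0 // ltW.
split=> f; first exact: repeat_test_complete.
move=> far; apply: (repeat_test_sound rho_gt0).
  by move: M_gt; rewrite ltr_pdivrMr // => /ltW.
rewrite biased_test_catch.
have -> : rho = rho0 / (14 * l).+1%:R by rewrite -natr1 natrM.
apply: uniform_catch_ge => //.
have far' := far_reduction n0 hp (hk _ hkp0) (hk _ hkp1) far.
case: (uniform_success I0 eps20 eps21 l_large far') => [h|]; last by right.
(* An edge success of 1 / N is at least [rho0], whose numerator is at most 1 and whose denominator
   is at least N. *)
left; apply: le_trans h; rewrite -/N /rho0 ler_pdivrMr; last first.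
  rewrite mulr_gt0 ?(lt_le_trans ltr01 N1) //.
  by rewrite mulr_gt0 ?exprn_gt0 // ltr0n.
have -> : N^-1 * (a * l%:R ^+ 5 * N) = a * l%:R ^+ 5 by field; rewrite gt_eqF //; lra.
apply: (@le_trans _ _ 1); first by rewrite exprn_ile1 // ltW.
by rewrite mulr_ege1 ?exprn_ege1 // /a mulr_ege1 // ler1n.
Qed.

Theorem theorem1p1 (R : realType) (p : R) (hp0 : 0 < p) (hp1 : p < 1) :
  exists T : forall n : nat, R -> nonadaptive_algorithm R n,
    soft_O (fun n eps => (query_complexity (T n eps))%:R)
           (fun n eps => Num.sqrt n%:R / eps ^+ 2) /\
    forall (n : nat) (eps : R), 0 < eps ->
      monotonicity_tester (biased p) eps (T n eps).
Proof.
have [C [C0 H]] := biased_tester hp0 hp1.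
have H' n eps : exists T : nonadaptive_algorithm R n, 0 < eps ->
    (query_complexity T)%:R <= C * (Num.sqrt n%:R / eps ^+ 2)
          * (ln (n%:R + 2) + ln (eps^-1 + 2)) ^+ 7 /\
      monotonicity_tester (biased p) eps T.
  (* For [eps <= 0] nothing is claimed, and a default algorithm makes the choice of [T] total. *)
  have [e0|e0] := ltP 0 eps; last by exists (accept_all R n).
  by have [T h1 h2] := H n eps e0; exists T.
exists (fun n eps => projT1 (cid (H' n eps))); split.
  exists C, 7%N => n eps e0; by case: cid => T /= /(_ e0) [].
by move=> n eps e0; case: cid => T /= /(_ e0) [].
Qed.
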